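(* Let $r\ge 2$ be an integer and let $H$ be a graph with maximum degree $\Delta(H)\ge 2$. There are constants $c=c(H,r)$ and $C=C(H,r)$ such that, if $p=p(n)\ge C n^{-1/m_2(H)}$, then for every positive integer $t$, $$\lim_{n\to\infty}\Pr\bigl(G(n,p)[c^t] \text{ is canonically } r\text{-Ramsey for } H[t]\bigr)=1.$$
   Context: $G(n,p)$ is the binomial random graph on $n$ vertices in which each edge is present independently with probability $p$. For a graph $J$, set $d_2(K_2)=1/2$ and $d_2(J)=\frac{e(J)-1}{v(J)-2}$ if $J\ne K_2$ (with $v(J)\ge 3$); the $2$-density of $H$ is $m_2(H)=\max\{d_2(J): J\subseteq H,\ e(J)\ge 1\}$. For a graph $G$ with vertices $v_1,\dots,v_m$ and a positive integer $n$, the $n$-blowup $G[n]$ is obtained by replacing each vertex $v_i$ by an independent set $U_i$ of $n$ vertices and, for every edge $v_iv_j$ of $G$, putting a complete bipartite graph between $U_i$ and $U_j$. A copy of $H[t]$ in $G[n]$ is canonical if there is a copy $H'$ of $H$ in $G$ and, for each vertex $v_i$ of $H'$, a set $S_i\subseteq U_i$ with $|S_i|=t$, such that the copy consists of $\bigcup S_i$ and all edges between $S_i$ and $S_j$ for every edge $v_iv_j$ of $H'$. $G[n]$ is canonically $r$-Ramsey for $H[t]$ if every colouring of the edges of $G[n]$ with $r$ colours contains a monochromatic canonical copy of $H[t]$. For non-integer $x$, $G[x]$ means $G[\lceil x\rceil]$. *)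

(* Defs.v *)
From HB Require Import structures.
From mathcomp Require Import all_boot all_order all_algebra.
From mathcomp Require Import all_classical all_reals all_analysis.

Set Implicit Arguments.
Unset Strict Implicit.
Unset Printing Implicit Defensive.

Import Order.TTheory GRing.Theory Num.Theory.
Import numFieldNormedType.Exports.

Local Open Scope ring_scope.

Section Graphs.
Variable V : finType.

Definition sgraph_axiom (X : {set V} * {set {set V}}) : bool :=
  [forall e in X.2, (#|e| == 2)%N && (e \subset X.1)].

(* A finite simple graph whose vertices are taken from the ambient type V,
   given by its vertex set and its set of edges; the vertex set need not be
   all of V, so that subgraphs live in the same type. *)
Record sgraph : Type := SGraph {
  sgraph_val :> {set V} * {set {set V}};
  sgraph_valP : sgraph_axiom sgraph_val
}.

HB.instance Definition _ := [isSub for sgraph_val].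
HB.instance Definition _ := [Finite of sgraph by <:].

Definition vset (G : sgraph) : {set V} := (sgraph_val G).1.
Definition eset (G : sgraph) : {set {set V}} := (sgraph_val G).2.

Definition subgraph (J G : sgraph) : bool :=
  (vset J \subset vset G) && (eset J \subset eset G).

Definition degree (G : sgraph) (v : V) : nat := #|[set e in eset G | v \in e]|.

Definition max_degree (G : sgraph) : nat := \max_(v in vset G) degree G v.

Definition pairs : {set {set V}} := [set e : {set V} | #|e| == 2%N].

Lemma spanning_subproof (E : {set {set V}}) :
  sgraph_axiom ([set: V], E :&: pairs).
Proof. by apply/forall_inP => e /=; rewrite !inE finset.subsetT andbT => /andP[]. Qed.

Definition spanning_graph (E : {set {set V}}) : sgraph :=
  SGraph (spanning_subproof E).

End Graphs.

(* Among graphs with at least one edge, the graphs with two vertices are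
   exactly the copies of K_2. *)
Definition d2 (R : realType) (V : finType) (J : sgraph V) : R :=
  if (#|vset J| == 2%N) && (#|eset J| == 1%N) then 2^-1
  else (#|eset J|%:R - 1) / (#|vset J|%:R - 2).

(* Every d2 J in the range is nonnegative, so the default value 0 only matters
   when H has no edge. *)
Definition m2 (R : realType) (V : finType) (H : sgraph V) : R :=
  \big[Num.max/0]_(J : sgraph V | subgraph J H && (0 < #|eset J|)%N) d2 R J.

Definition isomorphic (V W : finType) (G : sgraph V) (H : sgraph W) : Prop :=
  exists f : V -> W,
    [/\ {in vset G &, injective f},
        vset H = f @: vset G &
        eset H = [set f @: e | e : {set V} in eset G]].

Section Blowup.
Variables (V : finType) (N : nat).

(* The independent set U_v of N vertices replacing v. *)
Definition part (v : V) : {set V * 'I_N} := [set x | x.1 == v].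

Definition substV (G : sgraph V) (S : V -> {set V * 'I_N}) : {set V * 'I_N} :=
  \bigcup_(v in vset G) S v.

Definition substE (G : sgraph V) (S : V -> {set V * 'I_N}) :
    {set {set V * 'I_N}} :=
  \bigcup_(v in vset G) \bigcup_(w in vset G | [set v; w] \in eset G)
    [set [set x; y] | x in S v, y in S w].

Lemma blowup_subproof (G : sgraph V) :
  sgraph_axiom (substV G part, substE G part).
Proof.
apply/forall_inP => e /= /finset.bigcupP[v vG] /finset.bigcupP[w /andP[wG vwG]].
case/finset.imset2P => x y; rewrite !inE => /eqP xv /eqP yw ->.
have /forall_inP/(_ _ vwG) := sgraph_valP G.
rewrite cards2; case: (eqVneq v w) => // nvw _.
have nxy : x != y by apply: contraNneq nvw => xy; rewrite -xv -yw xy eqxx.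
rewrite cards2 nxy /=; apply/fintype.subsetP => z; rewrite !inE.
by case/orP => /eqP ->; apply/finset.bigcupP; [exists v | exists w];
  rewrite ?inE ?xv ?yw.
Qed.

Definition blowup (G : sgraph V) : sgraph (V * 'I_N)%type :=
  SGraph (blowup_subproof G).

Definition canonical_copy (W : finType) (H : sgraph W) (t : nat)
    (G : sgraph V) (K : sgraph (V * 'I_N)%type) : Prop :=
  subgraph K (blowup G) /\
  exists (H' : sgraph V) (S : V -> {set V * 'I_N}),
    [/\ subgraph H' G,
        isomorphic H H',
        forall v, v \in vset H' -> (S v \subset part v) /\ #|S v| = t,
        vset K = substV H' S &
        eset K = substE H' S].

Definition monochromatic (r : nat) (G K : sgraph (V * 'I_N)%type)
    (col : {e : {set V * 'I_N} | e \in eset G} -> 'I_r) : Prop :=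
  exists k : 'I_r, forall e, val e \in eset K -> col e = k.

Definition canonically_ramsey (W : finType) (r : nat) (H : sgraph W) (t : nat)
    (G : sgraph V) : Prop :=
  forall col : {e : {set V * 'I_N} | e \in eset (blowup G)} -> 'I_r,
    exists2 K, canonical_copy H t G K & monochromatic K col.

End Blowup.

(* Probability of A under the product measure in which each pair of vertices is
   an edge independently with probability p. *)
Definition Gnp_prob (R : realType) (n : nat) (p : R)
    (A : sgraph 'I_n -> Prop) : R :=
  \sum_(E in powerset (pairs 'I_n) | `[< A (spanning_graph E) >])
    \prod_(e in pairs 'I_n) (if e \in E then p else 1 - p).

(* Only meaningful for 0 <= x. *)
Definition ceil_nat (R : realType) (x : R) : nat := `|Num.ceil x|%N.

(* Main.v *)
(** A set of edges of [K_n] inducing few copies of [H] is captured, up to a small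
    exceptional part, by one of few "containers", each determined by a small
    fingerprint of the set and itself inducing few copies of [H].  By Ramsey's theorem
    the containers of the [r] colour classes of any colouring miss a positive proportion
    of the pairs, so a union bound over fingerprints shows that asymptotically almost
    surely no [r]-colouring of [G(n,p)] has only a small proportion of its copies of [H]
    monochromatic.

    Given a colouring of the blowup, colour [G(n,p)] through a random transversal:
    some copy of [H] in [G(n,p)] then has a positive proportion of its transversals
    monochromatic in one colour.  Nikiforov's argument extracts a monochromatic canonical
    [H[t]] from them as soon as the parts have size exponential in [t], and both that base
    and the constant [C] are fixed before [t]. *)
Require Import Defs.
From mathcomp Require Import all_boot all_order all_algebra.
From mathcomp Require Import zify ring lra.

Set Implicit Arguments.
Unset Strict Implicit.
Unset Printing Implicit Defensive.

Import Order.TTheory GRing.Theory Num.Theory.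

(** * Ramsey's theorem and blowups in shadows *)

(** A blowup without a monochromatic canonical copy does not give colour classes free of [H]: each
    may still contain a fraction [r / d] of the copies of [H] in [G(n,p)]. Hence containers are
    needed for arbitrary sets [I]: the part of [I] outside its container is charged to the copies
    that [I] induces. What this costs depends on the total number of copies in [G(n,p)], which a
    second moment bound controls.

    The union bound needs fingerprints much shorter than [p n^2], so the containers are run at
    density [q = p / C]. The leak then grows by a power of [C], which [d] has to absorb. This forces
    the order of choice: the Ramsey number [N], the proportions [eps] and [eta], the exponential
    parameter [L], then [C], then [d], and last the base [c].

    The threshold enters as the codegree condition of the containers: at density [n^(-1/m2(H))] or
    more, no set of edges lies in too many copies. A vertex of degree 2 gives [m2(H) >= 1], so that
    [p n^2 >= n] and the failure probability is [O(1/n)]. *)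

Lemma prehomogeneous_seq (T : finType) (r : nat) (chi : T -> T -> 'I_r) (m : nat)
    (D : {set T}) :
  (0 < r)%N -> (r.+1 ^ m <= #|D|)%N ->
  exists s : seq (T * 'I_r), [/\ size s = m, {subset [seq x.1 | x <- s] <= D} &
    pairwise (fun x y => (x.1 != y.1) && (chi x.1 y.1 == x.2)) s].
Proof.
move=> r0; elim: m D => [|m IH] D hD; first by exists [::].
have [x xD] : exists x, x \in D.
  by apply/set0Pn; rewrite -card_gt0; apply: leq_trans hD; rewrite expn_gt0.
(* The base is [r.+1] rather than [r] to cover the loss of [x] itself: [r] classes of fewer than
   [r.+1 ^ m] points cannot fill [D :\ x]. *)
have [i hi] : exists i : 'I_r, r.+1 ^ m <= #|[set y in D :\ x | chi x y == i]|.
  apply/existsP; apply: contraLR hD => /existsPn hi; rewrite -ltnNge.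
  have : #|D :\ x| <= \sum_(i < r) (r.+1 ^ m).-1.
    rewrite -sum1_card (partition_big (chi x) predT) //=.
    apply: leq_sum => i _; rewrite sum1dep_card -ltnS prednK ?expn_gt0 //.
    by have := hi i; rewrite -ltnNge.
  rewrite sum_nat_const card_ord (cardsD1 x D) xD expnS => h.
  have : 0 < r.+1 ^ m by rewrite expn_gt0.
  nia.
have [s [sz sD sp]] := IH _ hi.
exists ((x, i) :: s); split; rewrite /= ?sz //.
  move=> y; rewrite inE => /orP[/eqP-> //|/sD].
  by rewrite !inE -andbA => /and3P[].
rewrite sp andbT; apply/allP => y ys /=.
have : y.1 \in [set y0 in D :\ x | chi x y0 == i] by apply: sD; apply: map_f.
by rewrite !inE -andbA eq_sym => /and3P[-> _ ->].
Qed.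

(** Of the [r * #|W|] colours recorded along a prehomogeneous sequence, one occurs [#|W|] times, and
    the points recording it span only that colour. *)
Lemma ramsey_multicolor (W : finType) (r : nat) : (0 < r)%N ->
  exists N : nat, forall chi : 'I_N -> 'I_N -> 'I_r, (forall x y, chi x y = chi y x) ->
    exists (i : 'I_r) (h : W -> 'I_N),
      injective h /\ forall a b, a != b -> chi (h a) (h b) = i.
Proof.
move=> r0; exists (r.+1 ^ (r * #|W|)) => chi chiC.
set N := (r.+1 ^ _)%N in chi chiC *.
have [|s [sz _ sp]] := @prehomogeneous_seq _ r chi (r * #|W|) [set: 'I_N] r0.
  by rewrite cardsT card_ord.
have [i hi] : exists i : 'I_r, #|W| <= count (fun x => x.2 == i) s.
  apply/existsP; apply: contraT => /existsPn hi.
  have : size s = \sum_(i < r) count (fun x => x.2 == i) s.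
    under eq_bigr do rewrite -sum1_count.
    rewrite -sum1_size (exchange_big_dep predT) //=.
    by apply: eq_bigr => x _; rewrite (big_pred1 x.2).
  rewrite sz => h.
  have [W0|W0] := posnP #|W|; first by have := hi (Ordinal r0); rewrite W0.
  have : \sum_(i < r) count (fun x => x.2 == i) s <= \sum_(i < r) (#|W|.-1).
    by apply: leq_sum => j _; have := hi j; rewrite -ltnNge; lia.
  by rewrite -h sum_nat_const card_ord; nia.
exists i.
set u := [seq x <- s | x.2 == i].
have su : #|W| <= size u by rewrite size_filter.
have up : pairwise (fun x y => (x.1 != y.1) && (chi x.1 y.1 == i)) u.
  have : pairwise (fun x y => (x.1 != y.1) && (chi x.1 y.1 == x.2)) u.
    by apply: (subseq_pairwise _ sp); exact: filter_subseq.
  have : all (fun x => x.2 == i) u by exact: filter_all.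
  elim: (u) => //= x u' IH /andP[/eqP-> au] /andP[ax /(IH au) ->].
  by rewrite ax.
have N0 : 0 < N by rewrite expn_gt0.
pose x0 := (Ordinal N0, Ordinal r0).
pose h (a : W) := (nth x0 u (enum_rank a)).1.
have rk (a : W) : enum_rank a < size u by apply: leq_trans (ltn_ord _) su.
have key a b : enum_rank a < enum_rank b -> h a != h b /\ chi (h a) (h b) = i.
  move=> ab; have /(pairwiseP x0) := up.
  move=> /(_ (enum_rank a) (enum_rank b)); rewrite !inE !rk => /(_ isT isT ab).
  by case/andP => -> /eqP.
exists h; split.
  move=> a b eab; apply: enum_rank_inj; apply: val_inj.
  case: (ltngtP (enum_rank a) (enum_rank b)) => // /key[]; rewrite eab eqxx //.
move=> a b nab.
case: (ltngtP (enum_rank a) (enum_rank b)) => [/key[]//|/key[_]|].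
  by rewrite chiC.
by move/val_inj/enum_rank_inj => E; rewrite E eqxx in nab.
Qed.

Lemma card_ffun_extension (A B Y : finType) (h : A -> B) (f : A -> Y) :
  injective h ->
  #|[set g : {ffun B -> Y} | [forall a, g (h a) == f a]]| = (#|Y| ^ (#|B| - #|A|))%N.
Proof.
move=> hi.
pose F (b : B) : pred Y :=
  if [pick a | h a == b] is Some a then pred1 (f a) else predT.
have -> : #|[set g : {ffun B -> Y} | [forall a, g (h a) == f a]]| = #|family F|.
  apply: eq_card => g; rewrite !inE; apply/forallP/familyP => [hg b|hg a].
    by rewrite /F; case: pickP => [a /eqP <-|//]; rewrite !inE.
  have := hg (h a); rewrite /F; case: pickP => [a' /eqP/hi->|/(_ a)]; rewrite ?eqxx //.
rewrite card_family foldrE big_map big_enum /=.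
rewrite (bigID (mem (codom h))) /= big1 => [|b].
  rewrite mul1n (eq_bigr (fun=> #|Y|)) => [|b hb]; last first.
    rewrite /F; case: pickP => [a /eqP E|_]; first by rewrite -E codom_f in hb.
    by apply: eq_card => y; rewrite inE.
  rewrite prod_nat_const; congr (_ ^ _)%N.
  have := cardC (mem (codom h)); rewrite card_codom // => <-.
  by rewrite addKn; apply: eq_card => b; rewrite !inE.
case/codomP => a ->; rewrite /F; case: pickP => [a' _|/(_ a)]; last by rewrite eqxx.
exact: card1.
Qed.

(** This is all that a canonical blowup asks of a family: if [F] consists of monochromatic
    transversals of a copy, a shadow pair over an edge of [H] is an edge of the common colour. *)
Definition shadow (Y : finType) (h : nat) (F : {set h.-tuple Y}) (a b : 'I_h) (x y : Y) :=
  [exists s in F, (tnth s a == x) && (tnth s b == y)].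

Lemma card_set_sum (A B : finType) (P : A -> B -> bool) :
  \sum_(a : A) #|[set b | P a b]| = \sum_(b : B) #|[set a | P a b]|.
Proof.
under eq_bigr do rewrite -sum1dep_card big_mkcond.
rewrite exchange_big /=; apply: eq_bigr => b _.
by rewrite -sum1dep_card [RHS]big_mkcond.
Qed.

(* Nikiforov's argument.  The [t] chosen members of [F] are built coordinate by
   coordinate; being pairwise disjoint with every cross pair in the shadow, a subfamily
   extends to a new coordinate as soon as its members have [t] common extensions. *)
Lemma blowup_in_shadow (h d : nat) : (0 < d)%N ->
  exists2 c : nat, (0 < c)%N & forall (t : nat) (Y : finType) (F : {set h.-tuple Y}),
    (0 < t)%N -> (c ^ t <= #|Y|)%N -> (#|Y| ^ h <= d * #|F|)%N ->
    exists s : 'I_t -> h.-tuple Y,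
      [/\ forall i, s i \in F,
          forall a, injective (fun i => tnth (s i) a) &
          forall a b i j, a != b -> shadow F a b (tnth (s i) a) (tnth (s j) b)].
Proof.
elim: h d => [|h IH] d d0.
  exists 1%N => // t Y F t0 _; rewrite expn0 => hF.
  have [s sF] : exists s, s \in F by apply/set0Pn; rewrite -card_gt0; nia.
  by exists (fun=> s); split => // -[].
(* The density halves because only tuples with at least [#|Y| / (2 * d)] extensions are kept. *)
have [c c0 hc] := IH (2 * d)%N ltac:(lia).
(* The factor [c ^ (4 * d)] lets the induction supply [q = 4 * d * t] tuples instead of [t]; the
   other one gives [q * 2 ^ q <= #|Y|], needed for a pigeonhole over sets of tuples. *)
exists (c ^ (4 * d) * (4 * d * 2 * 2 ^ (4 * d)))%N.
  by rewrite !(muln_gt0, expn_gt0) c0 d0.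
move=> t Y F t0 hY hF.
set N := #|Y| in hY hF *.
have N0 : (0 < N)%N by apply: leq_trans hY; rewrite expn_gt0 !(muln_gt0, expn_gt0) c0 d0.
have hY1 : (c ^ (4 * d * t) <= N)%N.
  apply: leq_trans hY; rewrite expnMn expnM leq_pmulr // expn_gt0.
  by rewrite !(muln_gt0, expn_gt0) d0.
have hY2 : (4 * d * t * 2 ^ (4 * d * t) <= N)%N.
  apply: leq_trans hY; rewrite (expnMn (c ^ _)) -[X in (X <= _)%N]mul1n.
  apply: leq_mul; first by rewrite -expnM expn_gt0 c0.
  rewrite !expnMn -expnM leq_mul //; apply: leq_mul; last exact/ltnW/ltn_expl.
  by rewrite -expnMn -[X in (X <= _)%N]expn1 leq_pexp2l //; lia.
pose ext (s : h.-tuple Y) := [set y | [tuple of y :: s] \in F].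
pose F' := [set s | (N <= 2 * d * #|ext s|)%N].
have cF : (#|F| = \sum_(s : h.-tuple Y) #|ext s|)%N.
  pose tl (s : h.+1.-tuple Y) : h.-tuple Y := [tuple of behead s].
  rewrite -sum1_card (partition_big tl predT) //=.
  apply: eq_bigr => s _; rewrite sum1dep_card.
  rewrite -(card_imset (mem (ext s)) (f := fun y => [tuple of y :: s])); last first.
    by move=> y y' /(congr1 val)[].
  apply: eq_card => u; rewrite !inE; apply/andP/imsetP => [[uF /eqP E]|[y]].
    exists (thead u); last by rewrite -E -tuple_eta.
    by rewrite inE -E -tuple_eta.
  by rewrite inE => yF ->; split => //; apply/eqP/val_inj.
have hF' : (N ^ h <= 2 * d * #|F'|)%N.
  have : (2 * d * #|F| <= \sum_(s : h.-tuple Y) (N + (s \in F') * (2 * d * N)))%N.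
    rewrite cF big_distrr /=; apply: leq_sum => s _; rewrite inE.
    case: (leqP N (2 * d * #|ext s|)) => hs; last by rewrite mul0n addn0 ltnW.
    by rewrite mul1n -[X in (X <= _)%N]add0n leq_add // leq_mul //; exact: max_card.
  rewrite big_split /= sum_nat_const card_tuple -big_distrl /=.
  rewrite -sum1_card in hF *.
  have -> : (\sum_s (s \in F') = #|F'|)%N by rewrite -sum1_card [RHS]big_mkcond.
  rewrite sum1_card -/N => hh.
  move: hF; rewrite expnS sum1_card => hF.
  rewrite -(leq_pmul2l N0).
  move: (N ^ h)%N (#|F|) (#|F'|) hh hF; clear; move: N => N e f f'; lia.
have [s' [s'F' s'inj s'sh]] := hc (4 * d * t)%N Y F' ltac:(lia) hY1 hF'.
set q := (4 * d * t)%N in s' s'F' s'inj s'sh hY1 hY2 *.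
pose nb (y : Y) := [set i : 'I_q | y \in ext (s' i)].
pose good := [set y | (t <= #|nb y|)%N].
(* Each of the [q] tuples has at least [N / (2 * d)] extensions, so a value extends [2 * t] of them
   on average; values extending fewer than [t] account for at most half of the total. *)
have hgood : (N <= 4 * d * #|good|)%N.
  have h1 : (\sum_y #|nb y| = \sum_i #|ext (s' i)|)%N.
    rewrite /nb card_set_sum; apply: eq_bigr => i _.
    by apply: eq_card => y; rewrite inE.
  have h2 : (q * N <= 2 * d * \sum_i #|ext (s' i)|)%N.
    rewrite big_distrr /= -{1}(card_ord q) -sum_nat_const.
    by apply: leq_sum => i _; have := s'F' i; rewrite inE.
  have h3 : (\sum_y #|nb y| <= N * t + #|good| * q)%N.
    have -> : (N * t + #|good| * q = \sum_(y : Y) (t + if y \in good then q else 0))%N.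
      by rewrite big_split /= -big_mkcond !sum_nat_const.
    apply: leq_sum => y _ /=; rewrite inE.
    case: (leqP t #|nb y|) => hy; last by rewrite addn0 ltnW.
    rewrite -[X in (X <= _)%N]add0n leq_add //.
    by apply: leq_trans (max_card _) _; rewrite card_ord.
  rewrite h1 in h3.
  have h4 : (4 * d * t * N <= 2 * d * (N * t + #|good| * (4 * d * t)))%N.
    by apply: leq_trans h2 _; rewrite leq_mul2l h3 orbT.
  rewrite -(leq_pmul2l (_ : 0 < 2 * d * t)%N) ?muln_gt0 ?d0 ?t0 //; lia.
(* Sort the good values by the set of tuples they extend. There are at most [2 ^ q] classes, so [t]
   values share one set [A], and each of them extends every tuple in it. *)
have [A tA hA] : exists2 A : {set 'I_q}, (t <= #|A|)%N &
    (t <= #|[set y | nb y == A]|)%N.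
  apply/exists_inP; apply: contraT => /exists_inPn hA.
  have : (#|good| <= \sum_(A : {set 'I_q}) t.-1)%N.
    rewrite -sum1_card (partition_big nb (fun A => t <= #|A|)%N) /=; last first.
      by move=> y; rewrite inE.
    rewrite [X in (_ <= X)%N](bigID (fun A : {set 'I_q} => t <= #|A|)%N) /=.
    apply: leq_trans (leq_addr _ _); apply: leq_sum => A tA.
    have := hA A tA; rewrite -ltnNge -(ltnS _ t.-1) (prednK t0); apply: leq_trans.
    rewrite ltnS sum1dep_card; apply: subset_leq_card; apply/subsetP => y.
    by rewrite !inE => /andP[].
  rewrite sum_nat_const -cardsT -powersetT card_powerset cardsT card_ord => hg.
  have : (0 < 2 ^ q)%N by rewrite expn_gt0.
  move: (2 ^ q)%N hY2 hg => e hY2 hg e0.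
  have : (4 * d * #|good| <= 4 * d * (e * t.-1))%N by rewrite leq_mul2l hg orbT.
  have : (4 * d * (e * t.-1) < q * e)%N.
    by rewrite /q; have: (4 * d * e * t.-1 < 4 * d * e * t)%N;
      [rewrite ltn_pmul2l; [lia|nia]|lia].
  lia.
pose ai (i : 'I_t) : 'I_q := enum_val (widen_ord tA i).
pose yi (i : 'I_t) : Y := enum_val (widen_ord hA i).
have aiA i : ai i \in A by exact: enum_valP.
have yA i : nb (yi i) = A by apply/eqP; have := enum_valP (widen_ord hA i); rewrite inE.
have ai_inj : injective ai by move=> i j /enum_val_inj/(congr1 val)/= /val_inj.
have yi_inj : injective yi by move=> i j /enum_val_inj/(congr1 val)/= /val_inj.
have memF i j : [tuple of yi i :: s' (ai j)] \in F.
  have : ai j \in nb (yi i) by rewrite yA.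
  by rewrite !inE.
have F'F u : u \in F' -> exists y, [tuple of y :: u] \in F.
  rewrite inE => hu; have /set0Pn[y] : ext u != set0 by rewrite -card_gt0; nia.
  by rewrite inE; exists y.
exists (fun i => [tuple of yi i :: s' (ai i)]); split => //.
  move=> a i j; case: (unliftP ord0 a) => [b|] ->; last by move/yi_inj.
  by rewrite !tnthS => /s'inj/ai_inj.
move=> a b i j; case: (unliftP ord0 a) => [a'|] ->; case: (unliftP ord0 b) => [b'|] -> //.
- rewrite (inj_eq lift_inj) !tnthS => /s'sh - /(_ (ai i) (ai j))/exists_inP[u /F'F[y yu]].
  case/andP => u1 u2; apply/exists_inP; exists [tuple of y :: u] => //.
  by rewrite !tnthS u1.
- move=> _; rewrite tnthS !tnth0; apply/exists_inP.
  by exists [tuple of yi j :: s' (ai i)] => //; rewrite tnthS tnth0 !eqxx.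
- move=> _; rewrite tnthS !tnth0; apply/exists_inP.
  by exists [tuple of yi i :: s' (ai j)] => //; rewrite tnthS tnth0 !eqxx.
Qed.

Local Open Scope ring_scope.

(** * Hypergraph containers *)

Section Containers.
Variables (R : realFieldType) (X T : finType).
Implicit Types (S A B : {set T}) (e : T -> {set X}) (I F Q C P : {set X}).

(** Hyperedges are indexed by [T] through [e], so that embeddings with the same image, or edges that
    coincide once truncated, still count with multiplicity. *)
Definition codegree S e Q : nat := #|[set t in S | Q \subset e t]|.

Definition induced S e C : {set T} := [set t in S | e t \subset C].

Lemma sum_codegree S e : (\sum_Q codegree S e Q = \sum_(t in S) 2 ^ #|e t|)%N.
Proof.
under eq_bigr do rewrite /codegree -sum1dep_card big_mkcondr.
rewrite exchange_big /=; apply: eq_bigr => t _.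
by rewrite -big_mkcond /= -card_powerset sum1dep_card /powerset.
Qed.

Lemma sum_codegree1 S e P : {in S, forall t, e t \subset P} ->
  (\sum_(x in P) codegree S e [set x] = \sum_(t in S) #|e t|)%N.
Proof.
move=> eP; under eq_bigr do rewrite /codegree -sum1dep_card big_mkcondr.
rewrite exchange_big /=; apply: eq_bigr => t tS.
rewrite -big_mkcondr /= sum1dep_card; apply: eq_card => x; rewrite inE sub1set.
by apply/andP/idP => [[]//|xt]; rewrite (subsetP (eP t tS)).
Qed.

Lemma leq_codegree A S e Q : A \subset S -> (codegree A e Q <= codegree S e Q)%N.
Proof.
move=> AS; apply: subset_leq_card; apply/subsetP => t; rewrite !inE => /andP[tA ->].
by rewrite (subsetP AS).
Qed.

Lemma eq_codegree S e1 e2 Q : {in S, e1 =1 e2} -> codegree S e1 Q = codegree S e2 Q.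
Proof.
move=> E; apply: eq_card => t; rewrite !inE; case: (boolP (t \in S)) => //= tS.
by rewrite E.
Qed.

(** Vertices of degree below [theta] account for at most [a / 2] of the degree sum; the heavy ones,
    each of degree at most [dmax], must supply the rest. *)
Lemma heavy_card A e P (a theta dmax : R) :
    a <= #|A|%:R -> {in A, forall t, (0 < #|e t|)%N} -> {in A, forall t, e t \subset P} ->
    (forall x, (codegree A e [set x])%:R <= dmax) -> theta * #|P|%:R <= a / 2 ->
    0 < theta ->
  a / 2 <= #|[set x | theta <= (codegree A e [set x])%:R]|%:R * dmax.
Proof.
move=> aA e0 eP hd hX th0; set Z := [set x | _].
have h1 : #|A|%:R <= \sum_(x in P) ((codegree A e [set x])%:R : R).
  rewrite -natr_sum ler_nat (sum_codegree1 eP) -sum1_card.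
  by apply: leq_sum => t tA; apply: e0.
have h2 : \sum_(x in P) ((codegree A e [set x])%:R : R)
    <= \sum_(x in P) ((if x \in Z then dmax else 0) + theta).
  apply: ler_sum => x _; rewrite inE; case: (lerP theta _) => hx.
    by rewrite -[X in X <= _]addr0 lerD // ltW.
  by rewrite add0r ltW.
have h3 : \sum_(x in P) ((if x \in Z then dmax else 0) + theta)
    = #|Z|%:R * dmax + theta * #|P|%:R.
  rewrite big_split /= -big_mkcondr /= !sumr_const mulr_natl mulr_natr.
  congr (_ *+ _ + _); apply: eq_card => x.
  rewrite -[LHS]/((x \in P) && (x \in Z)) inE.
  apply/andP/idP => [[]//|hx]; split=> //.
  have : (0 < codegree A e [set x])%N by rewrite -(ltr_nat R) (lt_le_trans th0).
  rewrite card_gt0 => /set0Pn[t]; rewrite inE sub1set => /andP[tA xt].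
  exact: (subsetP (eP t tA)).
lra.
Qed.

(* One level of the container algorithm scans the vertices once, in a fixed order.
   Picking a vertex moves the available edges through it to [taken], with that vertex
   removed, and discards the available edges containing some [Q] already covered [D #|Q|]
   times.  Unpicked vertices leave the state unchanged, so a run is determined by
   [picks]. *)
Record state := State {
  avail : {set T}; taken : {set T}; resid : T -> {set X}; picks : {set X} }.

Section Level.
Variables (D : nat -> R) (beta theta : R).

Definition pick (st : state) (x : X) : state :=
  let B := taken st :|: [set t in avail st | x \in resid st t] in
  let rho t := if (t \in avail st) && (x \in resid st t) then resid st t :\ x
               else resid st t in
  let A := [set t in avail st | (x \notin resid st t) &&
    [forall Q : {set X}, (Q != set0) && (Q \subset resid st t) ==>
       ((codegree B rho Q)%:R < D #|Q|)]] in
  State A B rho (x |: picks st).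

Definition step I (st : state) (x : X) : state :=
  if [&& x \in I, theta <= (codegree (avail st) (resid st) [set x])%:R &
         #|taken st|%:R < beta]
  then pick st x else st.

Definition run I S e : state := foldl (step I) (State S set0 e set0) (enum X).

Lemma picks_step I st x : picks st \subset picks (step I st x).
Proof. by rewrite /step; case: ifP => // _; exact: subsetUr. Qed.

Lemma picks_foldl I st l : picks st \subset picks (foldl (step I) st l).
Proof.
elim: l st => //= x l IH st; apply: subset_trans (IH _); exact: picks_step.
Qed.

(** Every vertex that changed the state is recorded in [picks]; a vertex of [I] that did not change
    it failed a test that does not mention [I]. So the scan replays identically on any set between
    the fingerprint and [I]. *)
Lemma foldl_step_stable I I' st l :
  picks (foldl (step I) st l) \subset I' -> I' \subset I ->
  foldl (step I') st l = foldl (step I) st l.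
Proof.
elim: l st => //= x l IH st h II'.
suff E : step I' st x = step I st x by rewrite E IH.
have h' := subset_trans (picks_foldl I (step I st x) l) h.
move: h'; rewrite /step; case: ifP => [/and3P[xI -> ->]|hx] h'.
  by rewrite (subsetP h') //= setU11.
case: ifP => // /and3P[xI' h1 h2].
by rewrite (subsetP II' _ xI') h1 h2 in hx.
Qed.

Lemma run_stable I I' S e :
  picks (run I S e) \subset I' -> I' \subset I -> run I' S e = run I S e.
Proof. exact: foldl_step_stable. Qed.

Variables (S : {set T}) (e : T -> {set X}) (Delta : nat -> R).
Hypothesis D_gt0 : forall l, 0 < D l.
Hypothesis Delta_ge0 : forall l, 0 <= Delta l.
Hypothesis theta_gt0 : 0 < theta.
Hypothesis beta_ge0 : 0 <= beta.
Hypothesis codegree_le : forall Q, Q != set0 -> (codegree S e Q)%:R <= Delta #|Q|.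

(** The taken edges must be a legitimate input for the next level, hence [codegree_taken]. A taken
    edge whose residue lies in [I] must lie in [I] itself, hence [resid_picks]. Every pick takes at
    least [theta] new edges, which bounds the length of the fingerprint. *)
Record invariant I (st : state) : Prop := Invariant {
  avail_sub : avail st \subset S;
  taken_sub : taken st \subset S;
  availN : {in avail st, forall t, t \notin taken st};
  resid_avail : {in avail st, resid st =1 e};
  resid_sub : {in taken st, forall t, resid st t \subset e t};
  resid_card : {in taken st, forall t, #|resid st t|.+1 = #|e t|};
  resid_picks : {in taken st, forall t, e t :\: resid st t \subset picks st};
  codegree_taken : forall Q, Q != set0 ->
    (codegree (taken st) (resid st) Q)%:R <= D #|Q| + Delta #|Q|.+1;
  avail_unsat : forall t Q, t \in avail st -> Q != set0 -> Q \subset e t ->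
    (codegree (taken st) (resid st) Q)%:R < D #|Q|;
  removed_sat : forall t, t \in S -> t \notin avail st -> t \notin taken st ->
    exists Q, [/\ Q != set0, Q \subset e t &
      D #|Q| <= (codegree (taken st) (resid st) Q)%:R];
  picks_sub : picks st \subset I;
  picks_taken : #|picks st|%:R * theta <= #|taken st|%:R;
  picks_card : #|picks st|%:R * theta <= beta + theta }.

Lemma invariant_init I : invariant I (State S set0 e set0).
Proof.
split => //=; try by move=> t; rewrite inE.
- exact: sub0set.
- move=> Q _; rewrite /codegree (_ : [set t in _ | _] = set0) ?cards0 ?addr_ge0 //.
    exact: ltW.
  by apply/setP => t; rewrite !inE.
- move=> t Q _ _ _; rewrite /codegree (_ : [set t in _ | _] = set0) ?cards0 //.
  by apply/setP => t'; rewrite !inE.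
- by move=> t ->.
- exact: sub0set.
- by rewrite !cards0 mul0r.
- by rewrite cards0 mul0r addr_ge0 // ltW.
Qed.

Lemma invariant_pick I st x : x \in I ->
    theta <= (codegree (avail st) (resid st) [set x])%:R -> #|taken st|%:R < beta ->
  invariant I st -> invariant I (pick st x).
Proof.
move=> xI hth hb inv.
have [h1 h2 h3 h4 h5 h6 h7 h8 h9 h10 h11 h12 h13] := inv.
set N := [set t in avail st | x \in resid st t].
set B := taken st :|: N.
set rho := fun t => if (t \in avail st) && (x \in resid st t) then resid st t :\ x
               else resid st t.
have rhoB t : t \in taken st -> rho t = resid st t.
  by rewrite /rho => tB; case: ifP => // /andP[/h3]; rewrite tB.
have rhoN t : t \in N -> rho t = e t :\ x.
  by rewrite inE /rho => /andP[tA ->]; rewrite tA /= h4.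
have cN : #|N| = codegree (avail st) (resid st) [set x].
  by apply: eq_card => t; rewrite !inE sub1set.
have cB : #|B| = (#|taken st| + #|N|)%N.
  rewrite cardsU (_ : _ :&: _ = set0) ?cards0 ?subn0 //.
  apply/setP => t; rewrite !inE; apply/negP => /and3P[tB /h3].
  by rewrite tB.
have dgB Q : (codegree B rho Q
    <= codegree (taken st) (resid st) Q + #|[set t in N | Q \subset e t :\ x]|)%N.
  apply: leq_trans (leq_card_setU _ _); apply: subset_leq_card.
  apply/subsetP => t /setIdP[/setUP[tB|tN] hQ]; apply/setUP; [left|right]; apply/setIdP.
    by rewrite -rhoB.
  by rewrite -rhoN.
have dgB' Q : (codegree (taken st) (resid st) Q <= codegree B rho Q)%N.
  apply: subset_leq_card; apply/subsetP => t; rewrite !inE => /andP[tB hQ].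
  by rewrite tB rhoB.
split => /=; rewrite -/N -/B -/rho.
- by apply/subsetP => t; rewrite inE => /andP[tA _]; exact: (subsetP h1).
- rewrite subUset h2; apply/subsetP => t; rewrite inE => /andP[tA _].
  exact: (subsetP h1).
- move=> t; rewrite !inE => /and3P[tA /negbTE -> _].
  by rewrite andbF orbF h3.
- move=> t; rewrite inE => /and3P[tA xt _].
  by rewrite (negbTE xt) andbF h4.
- move=> t tBN; rewrite -/(rho t); case/setUP: tBN => [tB|tN]; first by rewrite rhoB // h5.
  by rewrite rhoN // subD1set.
- move=> t tBN; rewrite -/(rho t); case/setUP: tBN => [tB|tN]; first by rewrite rhoB // h6.
  rewrite rhoN // [in RHS](cardsD1 x); move: tN; rewrite inE => /andP[tA].
  by rewrite h4 // => ->.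
- move=> t tBN; rewrite -/(rho t); case/setUP: tBN => [tB|tN].
    by rewrite rhoB //; apply: subset_trans (h7 t tB) (subsetUr _ _).
  by rewrite rhoN //; apply/subsetP => y; rewrite !inE; case: (y == x) => //=; case: (y \in e t).
(* In one pick an unsaturated [Q] gains only edges containing [x |: Q], at most [Delta #|Q|.+1] of
   them. A saturated [Q] gains nothing, since no available edge contains it. *)
- move=> Q Q0; case: (ltrP ((codegree (taken st) (resid st) Q)%:R) (D #|Q|)) => hQ.
    have : (codegree B rho Q)%:R <= (codegree (taken st) (resid st) Q)%:R
        + (#|[set t in N | Q \subset e t :\ x]|%:R : R) by rewrite -natrD ler_nat dgB.
    suff : (#|[set t in N | Q \subset e t :\ x]|%:R : R) <= Delta #|Q|.+1 by lra.
    have [xQ|xQ] := boolP (x \in Q).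
      rewrite (_ : [set t in N | _] = set0) ?cards0 //.
      apply/setP => t; rewrite !inE; apply/negP => /andP[_ /subsetP/(_ _ xQ)].
      by rewrite !inE eqxx.
    have <- : #|x |: Q| = #|Q|.+1 by rewrite cardsU1 xQ.
    apply: le_trans (codegree_le (_ : x |: Q != set0)).
      rewrite ler_nat; apply: subset_leq_card; apply/subsetP => t.
      rewrite !inE => /andP[/andP[tA xt] Qt]; rewrite (subsetP h1) //= subUset sub1set.
      by rewrite -h4 // xt h4 // (subset_trans Qt) // subD1set.
    by apply/set0Pn; exists x; rewrite setU11.
  have E : [set t in N | Q \subset e t :\ x] = set0.
    apply/setP => t; rewrite !inE; apply/negP => /andP[/andP[tA xt] Qt].
    have := h9 t Q tA Q0 (subset_trans Qt (subD1set _ _)).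
    by rewrite ltNge hQ.
  have := dgB Q; rewrite E cards0 addn0 => hle.
  by apply: le_trans (h8 Q Q0); rewrite ler_nat.
- move=> t Q; rewrite inE => /and3P[tA xt /forallP hQ] Q0 Qt.
  by have /implyP := hQ Q; apply; rewrite Q0 h4.
- move=> t tS; rewrite inE => tA; rewrite inE negb_or => /andP[tB].
  rewrite inE => tN.
  have [tA'|tA'] := boolP (t \in avail st); last first.
    have [Q [Q0 Qt hQ]] := h10 t tS tA' tB.
    by exists Q; split => //; apply: le_trans hQ _; rewrite ler_nat.
  rewrite tA' /= in tA tN; rewrite tN /= in tA.
  move: tA; rewrite negb_forall => /existsP[Q]; rewrite negb_imply h4 // -leNgt.
  by case/andP => /andP[Q0 Qt] hQ; exists Q.
- by rewrite subUset h11 sub1set xI.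
- have c1 : (#|x |: picks st|%:R : R) <= 1 + #|picks st|%:R.
    by rewrite nat1r ler_nat cardsU1; case: (x \notin _).
  rewrite cB natrD cN; have := theta_gt0; nra.
- have c1 : (#|x |: picks st|%:R : R) <= 1 + #|picks st|%:R.
    by rewrite nat1r ler_nat cardsU1; case: (x \notin _).
  have := theta_gt0; nra.
Qed.

Lemma invariant_step I st x : invariant I st -> invariant I (step I st x).
Proof.
by move=> inv; rewrite /step; case: ifP => // /and3P[*]; apply: invariant_pick.
Qed.

Lemma invariant_foldl I st l : invariant I st -> invariant I (foldl (step I) st l).
Proof. by elim: l st => //= x l IH st inv; apply: IH; apply: invariant_step. Qed.

Lemma invariant_run I : invariant I (run I S e).
Proof. exact/invariant_foldl/invariant_init. Qed.

Lemma step_mono I st x :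
  (avail (step I st x) \subset avail st) && (taken st \subset taken (step I st x)).
Proof.
rewrite /step; case: ifP => _; last by rewrite !subxx.
by rewrite subsetUl andbT; apply/subsetP => t; rewrite inE => /andP[].
Qed.

Lemma foldl_mono I st l : (avail (foldl (step I) st l) \subset avail st) &&
  (taken st \subset taken (foldl (step I) st l)).
Proof.
elim: l st => /= [|x l IH] st; first by rewrite !subxx.
have /andP[h1 h2] := step_mono I st x; have /andP[h3 h4] := IH (step I st x).
by rewrite (subset_trans h3 h1) (subset_trans h2 h4).
Qed.

(** As [taken] only grows, the cap [beta] was not reached when [x] was scanned. Either [x] was
    picked, and no available edge contains it any more, or its degree was already below [theta];
    later steps only lose available edges. *)
Lemma foldl_low_degree I st l x : invariant I st -> x \in l -> x \in I ->
  #|taken (foldl (step I) st l)|%:R < beta ->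
  (codegree (avail (foldl (step I) st l)) e [set x])%:R < theta.
Proof.
elim: l st => //= y l IH st inv; rewrite inE => /orP[/eqP <-|xl] xI hb; last first.
  by apply: IH => //; apply: invariant_step.
have /andP[h1 h2] := foldl_mono I (step I st x) l.
have /andP[h3 h4] := step_mono I st x.
have hb' : #|taken st|%:R < beta.
  by apply: le_lt_trans hb; rewrite ler_nat subset_leq_card // (subset_trans h4).
apply: le_lt_trans (_ : (codegree (avail (step I st x)) e [set x])%:R < theta).
  by rewrite ler_nat leq_codegree.
rewrite /step xI hb' andbT /=.
case: (lerP theta (codegree (avail st) (resid st) [set x])%:R) => hth; last first.
  by rewrite -(eq_codegree _ (resid_avail inv)).
rewrite /codegree (_ : [set t in _ | _] = set0) ?cards0 //.
apply/setP => t; rewrite !inE; apply/negP => /andP[/and3P[tA xt _]].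
by rewrite sub1set -(resid_avail inv) // (negbTE xt).
Qed.

Lemma run_low_degree I x : x \in I -> #|taken (run I S e)|%:R < beta ->
  (codegree (avail (run I S e)) e [set x])%:R < theta.
Proof.
by move=> xI; apply: foldl_low_degree => //; [exact: invariant_init|rewrite mem_enum].
Qed.

(** A discarded edge contains a saturated [Q], and [S] has at most [gamma * D #|Q|] edges through
    such a [Q], that is at most [gamma] times its codegree in [taken]. Summed over all [Q], these
    codegrees amount to [2 ^ j] per taken edge. *)
Lemma run_removed I (gamma : R) (j : nat) : 0 <= gamma ->
    (forall l, (0 < l)%N -> Delta l <= gamma * D l) ->
    {in S, forall t, #|e t| = j.+1} ->
  #|S|%:R <= #|avail (run I S e)|%:R
    + #|taken (run I S e)|%:R * (1 + gamma * (2 ^ j)%:R).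
Proof.
move=> g0 hD hj; set st := run I S e.
have inv : invariant I st by exact: invariant_run.
pose sat := [set Q : {set X} | (Q != set0) &&
  (D #|Q| <= (codegree (taken st) (resid st) Q)%:R)].
pose rm := [set t in S | [exists Q in sat, Q \subset e t]].
have h1 : (#|S| <= #|avail st| + #|taken st| + #|rm|)%N.
  apply: leq_trans (leq_trans (leq_card_setU (avail st :|: taken st) rm) _); last first.
    by rewrite leq_add2r leq_card_setU.
  apply: subset_leq_card; apply/subsetP => t tS; rewrite 2!inE.
  case: (boolP (t \in avail st)) => //= tA; case: (boolP (t \in taken st)) => //= tB.
  rewrite inE tS /=; have [Q [Q0 Qt hQ]] := removed_sat inv tS tA tB.
  by apply/exists_inP; exists Q => //; rewrite inE Q0.
have h2 : (#|rm| <= \sum_(Q in sat) codegree S e Q)%N.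
  rewrite /codegree; under eq_bigr do rewrite -sum1dep_card big_mkcondr.
  rewrite exchange_big /= -sum1dep_card big_mkcondr; apply: leq_sum => t tS.
  case: ifP => // /exists_inP[Q Qs Qt].
  by rewrite (bigD1 Q) //= Qt.
have h3 : ((\sum_(Q in sat) codegree S e Q)%N%:R : R)
    <= gamma * (#|taken st|%:R * (2 ^ j)%:R).
  rewrite natr_sum.
  have -> : #|taken st|%:R * (2 ^ j)%:R
      = \sum_Q ((codegree (taken st) (resid st) Q)%:R : R).
    rewrite -natr_sum sum_codegree -natrM; congr (_%:R).
    rewrite -sum_nat_const; apply: eq_bigr => t tB; congr (_ ^ _)%N.
    have tS := subsetP (taken_sub inv) _ tB.
    by have := resid_card inv tB; rewrite hj // => -[].
  rewrite (bigID (mem sat) predT) /= mulrDr -[X in X <= _]addr0.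
  apply: lerD; last by rewrite mulr_ge0 // sumr_ge0.
  rewrite big_distrr /=; apply: ler_sum => Q; rewrite inE => /andP[Q0 hQ].
  apply: le_trans (codegree_le Q0) _.
  apply: le_trans (hD _ _) _; first by rewrite card_gt0.
  by rewrite ler_wpM2l.
have : (#|S|%:R : R) <= #|avail st|%:R + #|taken st|%:R + (\sum_(Q in sat) codegree S e Q)%N%:R.
  by rewrite -!natrD ler_nat (leq_trans h1) // leq_add2l.
rewrite mulrDr mulr1; have := h3; lra.
Qed.

End Level.
End Containers.

Section ContainerConstants.
Variable R : realFieldType.

(** Chosen so that a run taking fewer than [next_density j c K * (q * u)] edges takes or discards at
    most a quarter of the [c * u] edges available. *)
Definition next_density (j : nat) (c K : R) : R := c / (4 * (1 + K * (2 ^ j)%:R)).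

(** The minimum is over the levels at which the algorithm may stop. The codegree constant grows to
    [K + 1] because the codegree of a [Q] among the taken edges may exceed its threshold by one last
    pick. *)
Fixpoint shrink (j : nat) (c K : R) : R :=
  if j is j'.+1 then Num.min (c / (4 * K)) (shrink j' (next_density j c K) (K + 1))
  else c / (4 * K).

(** No minimum here: a run that stops before uniformity one excludes no vertex of [I], so only the
    bottom level leaks. *)
Fixpoint leak (j : nat) (c K : R) : R :=
  if j is j'.+1 then leak j' (next_density j c K) (K + 1) else c / 4.

Lemma next_density_gt0 (j : nat) (c K : R) : 0 < c -> 0 < K -> 0 < next_density j c K.
Proof.
move=> c0 K0; rewrite divr_gt0 // mulr_gt0 // addr_gt0 // mulr_gt0 //.
by rewrite ltr0n expn_gt0.
Qed.

Lemma shrink_gt0 (j : nat) (c K : R) : 0 < c -> 0 < K -> 0 < shrink j c K.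
Proof.
elim: j c K => [|j IH] c K c0 K0; first by rewrite /= divr_gt0 // mulr_gt0.
rewrite [shrink _ _ _]/= lt_min divr_gt0 ?mulr_gt0 //=.
by apply: IH; [exact: next_density_gt0|rewrite addr_gt0].
Qed.

Lemma leak_gt0 (j : nat) (c K : R) : 0 < c -> 0 < K -> 0 < leak j c K.
Proof.
elim: j c K => [|j IH] c K c0 K0; first by rewrite /= divr_gt0.
by apply: IH; [exact: next_density_gt0|rewrite addr_gt0].
Qed.

End ContainerConstants.

Section Containers.
Variables (R : realFieldType) (X T : finType) (P : {set X}) (q M : R).
Implicit Types (S : {set T}) (e : T -> {set X}) (I F Q C : {set X}).

(* [container j] treats [j.+1]-uniform hypergraphs; it returns the fingerprint and the
   set of vertices excluded from the container. *)
Fixpoint container (j : nat) (c K u : R) S e I : {set X} * {set X} :=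
  if j is j'.+1 then
    let c' := next_density j c K in
    let st := run (fun l => q ^+ l * u / M) (c' * (q * u)) (c' * u / M) I S e in
    if c' * (q * u) <= #|taken st|%:R then
      let FZ := container j' c' (K + 1) (q * u) (taken st) (resid st) I in
      (picks st :|: FZ.1, FZ.2)
    else (picks st, [set x | c' * u / M <= (codegree (avail st) e [set x])%:R])
  else (set0, [set x | c / 4 * u / M <= (codegree S e [set x])%:R]).

Lemma container_stable (j : nat) (c K u : R) S e I I' :
  (container j c K u S e I).1 \subset I' -> I' \subset I ->
  container j c K u S e I' = container j c K u S e I.
Proof.
elim: j c K u S e => [|j IH] c K u S e //.
rewrite [container _ _ _ _ _ _ I]/= [container _ _ _ _ _ _ I']/=.
set c' := next_density _ _ _; set st := run _ _ _ I _ _.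
move=> h II'.
have hst : picks st \subset I'.
  by move: h; case: ifP => // _ /=; rewrite subUset => /andP[].
rewrite (run_stable hst II') -/st; case: ifP h => // _ /= h.
by rewrite IH //; move: h; rewrite subUset => /andP[].
Qed.

Hypothesis q_gt0 : 0 < q.
Hypothesis q_le1 : q <= 1.
Hypothesis M_gt0 : 0 < M.
Hypothesis card_P : #|P|%:R <= M.
Hypothesis qM_ge1 : 1 <= q * M.

(** Either the run takes many edges, whose residues are spread at scale [q * u] and have one vertex
    fewer, so that the induction applies to them; or most edges remain available, and the vertices
    of high degree among these are numerous and all outside [I]. *)
Lemma container_spec (j : nat) (c K u : R) S e I :
    0 < c -> 0 < K -> 0 < u -> {in S, forall t, e t \subset P} ->
    {in S, forall t, #|e t| = j.+1} -> c * u <= #|S|%:R ->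
    (forall Q, Q != set0 -> (codegree S e Q)%:R <= K * q ^+ #|Q|.-1 * u / M) ->
  let FZ := container j c K u S e I in
  [/\ FZ.1 \subset I, #|FZ.1|%:R <= 2 * j%:R * (q * M),
      shrink j c K * M <= #|FZ.2|%:R,
      {in FZ.2, forall x, exists2 t, t \in S & x \in e t} &
      #|I :&: FZ.2|%:R * (leak j c K * q ^+ j * u / M) <= #|induced S e I|%:R].
Proof.
elim: j c K u S e => [|j IH] c K u S e c0 K0 u0 hP hS cS spread.
  rewrite /=; set Z := [set x | _].
  have th0 : 0 < c / 4 * u / M by rewrite !divr_gt0 // mulr_gt0 // divr_gt0.
  split.
  - exact: sub0set.
  - by rewrite cards0 mulr0 mul0r.
  - have := @heavy_card _ _ _ S e P (c * u) (c / 4 * u / M) (K * u / M) cS.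
    rewrite -/Z => /(_ _ _ _ _ th0) h.
    have h' : c * u / 2 <= #|Z|%:R * (K * u / M).
      apply: h.
      + by move=> t /hS ->.
      + exact: hP.
      + move=> x; have := spread [set x]; rewrite cards1 expr0 mulr1; apply.
        by apply/set0Pn; exists x; rewrite set11.
      + have -> : c / 4 * u / M * #|P|%:R = c * u / 4 * (#|P|%:R / M) by field; rewrite gt_eqF.
        have : #|P|%:R / M <= 1 by rewrite ler_pdivrMr // mul1r.
        have : 0 < c * u by rewrite mulr_gt0.
        move: (c * u) (_ / M) => a b; nra.
    have -> : c / (4 * K) * M = c * u / 4 / (K * u / M) by field; rewrite !gt_eqF.
    rewrite ler_pdivrMr ?divr_gt0 ?mulr_gt0 //.
    apply: le_trans h'; have : 0 < c * u by rewrite mulr_gt0.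
    by lra.
  - move=> x; rewrite inE => hx.
    have : (0 < codegree S e [set x])%N by rewrite -(ltr_nat R) (lt_le_trans th0).
    rewrite card_gt0 => /set0Pn[t]; rewrite inE sub1set => /andP[tS xt].
    by exists t.
  (* At uniformity one, each vertex of [I :&: Z] carries at least [c / 4 * u / M] singleton edges,
     all of them induced by [I]. *)
  - rewrite expr0 mulr1.
    apply: le_trans (_ : \sum_(x in I :&: Z) (codegree S e [set x])%:R <= _).
      rewrite mulr_natl -sumr_const; apply: ler_sum => x; rewrite !inE.
      by case/andP.
    rewrite -natr_sum ler_nat /codegree.
    under eq_bigr do rewrite -sum1dep_card big_mkcondr.
    rewrite exchange_big /= -sum1dep_card [X in (_ <= X)%N]big_mkcondr.
    apply: leq_sum => t tS; have /eqP/cards1P[x ex] := hS t tS.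
    rewrite ex sub1set; case: (boolP (x \in I)) => xI; last first.
      rewrite big1 // => y; rewrite inE => /andP[yI _]; rewrite sub1set inE.
      by case: eqP => // E; rewrite E (negbTE xI) in yI.
    rewrite -big_mkcondr sum1dep_card -(cards1 x); apply: subset_leq_card.
    by apply/subsetP => y; rewrite !inE sub1set inE => /andP[].
rewrite [container _ _ _ _ _ _ _]/=.
set c' := next_density j.+1 c K.
set D := fun l : nat => q ^+ l * u / M.
set beta := c' * (q * u); set theta := c' * u / M.
set st := run D beta theta I S e.
have c'0 : 0 < c' by exact: next_density_gt0.
have D0 l : 0 < D l by rewrite /D divr_gt0 // mulr_gt0 // exprn_gt0.
have th0 : 0 < theta by rewrite divr_gt0 // mulr_gt0.
have b0 : 0 < beta by apply: mulr_gt0 => //; apply: mulr_gt0.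
pose Delta (l : nat) := K * q ^+ l.-1 * u / M.
have De0 l : 0 <= Delta l.
  by rewrite ltW // divr_gt0 // !mulr_gt0 // exprn_gt0.
have inv : invariant D beta theta S e Delta I st.
  by apply: invariant_run => //; exact: ltW.
(* There are at most [(beta + theta) / theta = q * M + 1] picks, and [1 <= q * M]. *)
have pc : #|picks st|%:R <= 2 * (q * M).
  have := picks_card inv; have -> : beta + theta = (q * M + 1) * theta.
    by rewrite /beta /theta; field; rewrite gt_eqF.
  by rewrite ler_pM2r // => h; apply: le_trans h _; rewrite mulr_natl mulr2n lerD2l.
have fold_spread Q : Q != set0 -> (codegree (taken st) (resid st) Q)%:R <=
    (K + 1) * q ^+ #|Q|.-1 * (q * u) / M.
  move=> Q0; apply: le_trans (codegree_taken inv Q0) _.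
  rewrite /D /Delta /=; move: Q0; rewrite -card_gt0; case: #|Q| => // l _ /=.
  by rewrite exprS le_eqVlt; apply/orP; left; apply/eqP; field; rewrite gt_eqF.
case: lerP => hb.
  have hB : {in taken st, forall t, #|resid st t| = j.+1}.
    move=> t tB; have := resid_card inv tB.
    by rewrite hS ?(subsetP (taken_sub inv)) // => -[].
  have hBP : {in taken st, forall t, resid st t \subset P}.
    move=> t tB; apply: subset_trans (resid_sub inv tB) _.
    exact/hP/(subsetP (taken_sub inv)).
  have K1 : 0 < K + 1 by lra.
  have qu0 : 0 < q * u by rewrite mulr_gt0.
  have [h1 h2 h3 h4 h5] := IH c' (K + 1) (q * u) (taken st) (resid st) c'0 K1 qu0 hBP hB hb
    fold_spread.
  rewrite /fst /snd; split.
  - by rewrite subUset (picks_sub inv).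
  - apply: le_trans (_ : #|picks st|%:R + #|(container j c' (K + 1) (q * u) (taken st) (resid st) I).1|%:R <= _).
      by rewrite -natrD ler_nat leq_card_setU.
    by move: h2; rewrite /= -[j.+1%:R]natr1; lra.
  - apply: le_trans h3; rewrite ler_pM2r // [shrink j.+1 _ _]/= ge_min.
    by rewrite lexx orbT.
  - move=> x /h4[t tB xt]; exists t; first exact: (subsetP (taken_sub inv)).
    exact: (subsetP (resid_sub inv tB)).
  - have -> : leak j.+1 c K * q ^+ j.+1 * u / M = leak j c' (K + 1) * q ^+ j * (q * u) / M.
      by rewrite [leak j.+1 _ _]/= exprS -/c'; field; rewrite gt_eqF.
    apply: le_trans h5 _; rewrite ler_nat; apply: subset_leq_card; apply/subsetP => t.
    rewrite !inE => /andP[tB tI]; rewrite (subsetP (taken_sub inv)) //=.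
    rewrite -(setID (e t) (resid st t)) subUset; apply/andP; split.
      by apply: subset_trans tI; exact: subsetIr.
    exact: subset_trans (resid_picks inv tB) (picks_sub inv).
rewrite /fst /snd; set Z := [set x | _]; split.
- exact: picks_sub inv.
- apply: le_trans pc _; rewrite ler_pM2r ?(lt_le_trans ltr01) //.
  by rewrite ler_peMr // ler1n.
(* [run_removed] is used with [gamma = K / q], the ratio of [Delta] to [D]. *)
- have hA : c * u / 2 <= #|avail st|%:R.
    have := @run_removed _ _ _ D beta theta S e Delta D0 De0 th0 (ltW b0) spread I (K / q) j.+1.
    rewrite -/st => /(_ _ _ hS) h.
    have h' : #|S|%:R <= #|avail st|%:R + #|taken st|%:R * (1 + K / q * (2 ^ j.+1)%:R).
      apply: h; first by rewrite ltW // divr_gt0.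
      move=> [//|l] _; rewrite /Delta /D /= exprS le_eqVlt; apply/orP; left; apply/eqP.
      by field; rewrite !gt_eqF.
    set E := (2 ^ j.+1)%:R in h' *.
    have E0 : 0 < E by rewrite ltr0n expn_gt0.
    have h2 : #|taken st|%:R * (1 + K / q * E) <= c * u / 4.
      apply: le_trans (_ : beta * (1 + K / q * E) <= _).
        by rewrite ler_pM2r ?ltW // addr_gt0 // mulr_gt0 // divr_gt0.
      have -> : beta * (1 + K / q * E) = c' * u * (q + K * E).
        by rewrite /beta; field; rewrite gt_eqF.
      have -> : c * u / 4 = c' * u * (1 + K * E).
        rewrite /c' /next_density -/E; field.
        by rewrite gt_eqF // addr_gt0 // mulr_gt0.
      by apply: ler_wpM2l; [exact: ltW (mulr_gt0 c'0 u0)|rewrite lerD2r].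
    by have : 0 < c * u by [rewrite mulr_gt0]; lra.
  have := @heavy_card _ _ _ (avail st) e P (c * u / 2) theta (K * u / M) hA.
  rewrite -/Z => /(_ _ _ _ _ th0) h.
  have h' : c * u / 2 / 2 <= #|Z|%:R * (K * u / M).
    apply: h.
    + by move=> t /(subsetP (avail_sub inv))/hS ->.
    + by move=> t /(subsetP (avail_sub inv))/hP.
    + move=> x; apply: le_trans (_ : (codegree S e [set x])%:R <= _).
        by rewrite ler_nat leq_codegree // (avail_sub inv).
      have := spread [set x]; rewrite cards1 expr0 mulr1; apply.
      by apply/set0Pn; exists x; rewrite set11.
    + have -> : theta * #|P|%:R = c' * u * (#|P|%:R / M) by rewrite /theta; field; rewrite gt_eqF.
      have a1 : #|P|%:R / M <= 1 by rewrite ler_pdivrMr // mul1r.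
      have a2 : c' <= c / 4.
        rewrite /c' /next_density ler_pM2l // lef_pV2 ?posrE //; last first.
          by rewrite mulr_gt0 // addr_gt0 // mulr_gt0 // ltr0n expn_gt0.
        rewrite -[X in X <= _]mulr1 ler_pM2l // lerDl ltW // mulr_gt0 //.
        by rewrite ltr0n expn_gt0.
      have a3 : c' * u * (#|P|%:R / M) <= c' * u.
        by rewrite -[X in _ <= X]mulr1; apply: ler_wpM2l => //; exact: ltW (mulr_gt0 c'0 u0).
      have a4 : c' * u <= c / 4 * u by rewrite ler_pM2r.
      by lra.
  apply: le_trans (_ : c / (4 * K) * M <= _).
    by rewrite ler_pM2r // [shrink j.+1 _ _]/= ge_min lexx.
  have -> : c / (4 * K) * M = c * u / 2 / 2 / (K * u / M) by field; rewrite !gt_eqF.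
  by rewrite ler_pdivrMr ?divr_gt0 ?mulr_gt0.
- move=> x; rewrite inE => hx.
  have : (0 < codegree (avail st) e [set x])%N by rewrite -(ltr_nat R) (lt_le_trans th0).
  rewrite card_gt0 => /set0Pn[t]; rewrite inE sub1set => /andP[tA xt].
  by exists t => //; exact: (subsetP (avail_sub inv)).
- rewrite (_ : I :&: Z = set0) ?cards0 ?mul0r //.
  apply/setP => x; rewrite !inE; apply/negP => /andP[xI].
  have := run_low_degree D0 De0 th0 (ltW b0) spread xI hb; rewrite -/st.
  by rewrite ltNge => /negbTE ->.
Qed.

Variables (j : nat) (eps K u : R) (S : {set T}) (e : T -> {set X}).
Hypothesis eps_gt0 : 0 < eps.
Hypothesis K_gt0 : 0 < K.
Hypothesis u_gt0 : 0 < u.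
Hypothesis edge_sub : {in S, forall t, e t \subset P}.
Hypothesis uniform : {in S, forall t, #|e t| = j.+1}.
Hypothesis spread : forall Q, Q != set0 ->
  (codegree S e Q)%:R <= K * q ^+ #|Q|.-1 * u / M.

Fixpoint containers (s : nat) C I : {set X} * {set X} :=
  if s is s'.+1 then
    if eps * u <= #|induced S e C|%:R then
      let FZ := container j eps K u (induced S e C) e I in
      let FC := containers s' (C :\: FZ.2) I in
      (FZ.1 :|: FC.1, FC.2)
    else (set0, C)
  else (set0, C).

Lemma containers_stable s C I I' :
  (containers s C I).1 \subset I' -> I' \subset I -> containers s C I' = containers s C I.
Proof.
elim: s C => //= s IH C; case: ifP => // _ /=.
rewrite subUset => /andP[h1 h2] II'.
by rewrite (container_stable h1 II') IH.
Qed.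

(** Each round removes at least [shrink j eps K * M] vertices from [C], so the fuel [s] outlasts the
    rounds; the strict hypothesis excludes [s = 0]. All rounds charge their leak to the same edges
    induced by [I], hence the factor [s]. *)
Lemma containers_spec s C I :
    #|C|%:R < s%:R * shrink j eps K * M ->
  let FC := containers s C I in
  [/\ FC.1 \subset I, #|FC.1|%:R <= s%:R * (2 * j%:R * (q * M)),
      #|induced S e FC.2|%:R < eps * u, FC.2 \subset C &
      #|(I :&: C) :\: FC.2|%:R * (leak j eps K * q ^+ j * u / M)
        <= s%:R * #|induced S e I|%:R].
Proof.
elim: s C => [|s IH] C; first by rewrite !mul0r ltNge ler0n.
move=> hC; rewrite [containers _ _ _]/=; case: lerP => hS; last first.
  split=> //=; first exact: sub0set.
  - by rewrite cards0 !mulr_ge0 ?ler0n // ltW.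
  - rewrite (_ : _ :\: _ = set0) ?cards0 ?mul0r ?mulr_ge0 //.
    by apply/setP => x; rewrite !inE; case: (x \in C); rewrite ?andbF.
set SC := induced S e C in hS *.
have SCS : SC \subset S by apply/subsetP => t; rewrite inE => /andP[].
have hSC : {in SC, forall t, #|e t| = j.+1} by move=> t /(subsetP SCS)/uniform.
have hSCP : {in SC, forall t, e t \subset P} by move=> t /(subsetP SCS)/edge_sub.
have spSC Q : Q != set0 -> (codegree SC e Q)%:R <= K * q ^+ #|Q|.-1 * u / M.
  by move=> /spread; apply: le_trans; rewrite ler_nat leq_codegree.
have [h1 h2 h3 h4 h5] := container_spec I eps_gt0 K_gt0 u_gt0 hSCP hSC hS spSC.
set FZ := container _ _ _ _ _ _ _ in h1 h2 h3 h4 h5 *.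
have ZC : FZ.2 \subset C.
  apply/subsetP => x /h4[t]; rewrite inE => /andP[_ /subsetP tC]; exact: tC.
have hC' : #|C :\: FZ.2|%:R < s%:R * shrink j eps K * M.
  rewrite cardsD (setIidPr ZC) natrB ?subset_leq_card //.
  by move: hC; rewrite -natr1 !mulrDl mul1r; lra.
have [g1 g2 g3 g4 g5] := IH _ hC'; set FC := containers _ _ _ in g1 g2 g3 g4 g5 *.
rewrite /fst /snd; split=> //.
- by rewrite subUset h1.
- apply: le_trans (_ : #|FZ.1|%:R + #|FC.1|%:R <= _).
    by rewrite -natrD ler_nat leq_card_setU.
  by rewrite -natr1 mulrDl mul1r; lra.
- exact: subset_trans g4 (subsetDl _ _).
- set L := leak _ _ _ * _ * _ / _ in h5 g5 *.
  have L0 : 0 < L by rewrite divr_gt0 // !mulr_gt0 ?leak_gt0 // exprn_gt0.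
  have : (#|(I :&: C) :\: FC.2| <= #|I :&: FZ.2| + #|(I :&: (C :\: FZ.2)) :\: FC.2|)%N.
    apply: leq_trans (leq_card_setU _ _); apply: subset_leq_card; apply/subsetP => x.
    by rewrite !inE; case: (x \in I); case: (x \in C); case: (x \in FZ.2); case: (x \in FC.2).
  rewrite -(ler_nat R) natrD -(ler_pM2r L0) mulrDl => h.
  apply: le_trans h _; rewrite -natr1 mulrDl mul1r addrC lerD //.
  apply: le_trans h5 _; rewrite ler_nat; apply: subset_leq_card; apply/subsetP => t.
  by rewrite !inE -andbA => /and3P[-> _ ->].
Qed.

End Containers.

(* [I] need not be independent: the last bound says how far it leaves its container. *)
Lemma hypergraph_containers (R : realFieldType) (j s : nat) (eps K : R) :
    0 < eps -> 0 < K -> 1 < s%:R * shrink j eps K ->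
  forall (X T : finType) (P : {set X}) (q M u : R) (S : {set T}) (e : T -> {set X}),
    0 < q -> q <= 1 -> 0 < M -> #|P|%:R <= M -> 1 <= q * M -> 0 < u ->
    {in S, forall t, e t \subset P} -> {in S, forall t, #|e t| = j.+1} ->
    (forall Q, Q != set0 -> (codegree S e Q)%:R <= K * q ^+ #|Q|.-1 * u / M) ->
  exists phi zeta : {set X} -> {set X}, forall I,
    [/\ phi I \subset I, zeta (phi I) = zeta I,
        #|phi I|%:R <= s%:R * (2 * j%:R * (q * M)),
        #|induced S e (zeta I)|%:R < eps * u &
        #|(I :&: P) :\: zeta I|%:R * (leak j eps K * q ^+ j * u / M)
          <= s%:R * #|induced S e I|%:R].
Proof.
move=> e0 K0 hs X T P q M u S e q0 q1 M0 PM qM u0 eP unif spread.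
pose cont := containers q M j eps K u S e s P.
exists (fun I => (cont I).1), (fun I => (cont I).2) => I.
have [|h1 h2 h3 h4 h5] := @containers_spec R X T P q M q0 q1 M0 PM qM j eps K u S e
  e0 K0 u0 eP unif spread s P I.
  by apply: le_lt_trans PM _; rewrite ltr_pMl.
by split => //; rewrite /cont (containers_stable (subxx _) h1).
Qed.

(** * Random subsets *)

From mathcomp Require Import reals sequences exp.

Lemma sum_powerset_prod (R : comPzRingType) (X : finType) (P : {set X}) (F G : X -> R) :
  \sum_(E in powerset P) \prod_(x in P) (if x \in E then F x else G x)
    = \prod_(x in P) (F x + G x).
Proof.
pose F' x := if x \in P then F x else 0.
pose G' x := if x \in P then G x else 1.
have -> : \prod_(x in P) (F x + G x) = \prod_x (F' x + G' x).
  rewrite big_mkcond; apply: eq_bigr => x _; rewrite /F' /G'.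
  by case: (x \in P); rewrite ?add0r.
rewrite bigA_distr /= (bigID (fun E => E \in powerset P) (fun=> true)) /=.
rewrite [X in _ = _ + X]big1 ?addr0 => [|E].
  apply: eq_bigr => E; rewrite powersetE => /subsetP EP.
  rewrite big_mkcond; apply: eq_bigr => x _; rewrite /F' /G'.
  by case: (boolP (x \in P)) => // xP; case: ifP => // /EP; rewrite (negbTE xP).
rewrite powersetE => /subsetPn[x xE xP].
by rewrite (bigD1 x) //= xE /F' (negbTE xP) mul0r.
Qed.

Section RandomSubset.
Variables (R : realType) (X : finType) (P : {set X}) (p : R).
Hypothesis p_ge0 : 0 <= p.
Hypothesis p_le1 : p <= 1.
Implicit Types (E F U : {set X}).

Definition weight E : R := \prod_(x in P) (if x \in E then p else 1 - p).

Definition prob (A : pred {set X}) : R := \sum_(E in powerset P | A E) weight E.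

Lemma weight_ge0 E : 0 <= weight E.
Proof. by apply: prodr_ge0 => x _; case: ifP => _ //; rewrite subr_ge0. Qed.

Lemma sum_weight : \sum_(E in powerset P) weight E = 1.
Proof.
rewrite sum_powerset_prod big1 // => x _; by rewrite addrC subrK.
Qed.

Lemma prob_contains F : F \subset P -> prob (fun E => F \subset E) = p ^+ #|F|.
Proof.
move=> FP.
have -> : p ^+ #|F| = \prod_(x in P) (p + if x \in F then 0 else 1 - p).
  rewrite -prodr_const (bigID (mem F) (mem P)) /= [X in _ = _ * X]big1 ?mulr1 => [|x].
    rewrite [RHS](eq_bigl (mem F)) => [|x] /=; last first.
      by case: (boolP (x \in F)) => [/(subsetP FP) ->|]; rewrite ?andbF.
    by apply: eq_bigr => x ->; rewrite addr0.
  by case/andP => _ /negbTE ->; rewrite addrC subrK.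
rewrite -sum_powerset_prod /prob big_mkcondr; apply: eq_bigr => E _.
case: ifP => [/subsetP FE|/negbT/subsetPn[x xF xE]].
  apply: eq_bigr => x _; case: ifP => // xE; case: ifP => // /FE.
  by rewrite xE.
by rewrite (bigD1 x) ?(subsetP FP) //= (negbTE xE) xF mul0r.
Qed.

(** On the event, [expR y * 2^-1 ^+ #|E :&: U|] is at least 1 because [2 <= expR 1]. Its expectation
    factorises over [P]; an element of [U] contributes [1 - p / 2], at most [expR (- (p / 2))]. [F]
    and [U] may overlap: the factor [2 * p] covers common elements. *)
Lemma prob_contains_sparse F U (y : R) : F \subset P -> U \subset P ->
  prob (fun E => (F \subset E) && (#|E :&: U|%:R <= y))
    <= expR (y - p * #|U|%:R / 2) * (2 * p) ^+ #|F|.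
Proof.
move=> FP UP; have p0 := p_ge0; have p1 := p_le1.
pose f x : R := if x \in U then p / 2 else p.
pose g x : R := if x \in F then 0 else 1 - p.
have h1 : prob (fun E => (F \subset E) && (#|E :&: U|%:R <= y)) <=
    \sum_(E in powerset P) expR y * \prod_(x in P) (if x \in E then f x else g x).
  rewrite /prob big_mkcondr; apply: ler_sum => E; rewrite powersetE => EP.
  have pg : 0 <= expR y * \prod_(x in P) (if x \in E then f x else g x).
    rewrite mulr_ge0 ?expR_ge0 // prodr_ge0 // => x _; rewrite /f /g.
    by do 2 case: ifP => _ //; lra.
  case: ifP => [/andP[FE hy]|_ //].
  have -> : \prod_(x in P) (if x \in E then f x else g x)
      = weight E * (2^-1) ^+ #|E :&: U|.
    have -> : (2^-1 : R) ^+ #|E :&: U| = \prod_(x in P) (if x \in E :&: U then 2^-1 else 1).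
      rewrite -big_mkcondr /= -prodr_const; apply: eq_bigl => x.
      by rewrite inE; case: (boolP (x \in U)) => [/(subsetP UP) ->|]; rewrite ?andbF.
    rewrite -big_split /=; apply: eq_bigr => x _; rewrite inE /f /g.
    case: ifP => xE /=; first by case: ifP; rewrite ?mulr1.
    rewrite mulr1; case: ifP => // xF; by rewrite (subsetP FE) in xE.
  rewrite mulrCA -[X in X <= _]mulr1 ler_wpM2l ?weight_ge0 //.
  have e2 : (2 : R) <= expR 1 by have := @expR_ge1Dx R 1; lra.
  have : expR (- #|E :&: U|%:R) <= (2^-1 : R) ^+ #|E :&: U|.
    rewrite expRN -[#|_|%:R]mulr1 -mulr_natl mulr1 expRM_natl -exprVn.
    apply: lerXn2r; rewrite ?nnegrE ?invr_ge0 ?expR_ge0 //.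
    by rewrite lef_pV2 ?posrE ?expR_gt0.
  have : 1 <= expR y * expR (- #|E :&: U|%:R).
    by rewrite -expRD -[X in X <= _]expR0 ler_expR subr_ge0.
  move=> h1 h2; apply: le_trans h1 _; exact: ler_wpM2l (expR_ge0 _) _ _ h2.
apply: le_trans h1 _; rewrite -big_distrr /= sum_powerset_prod.
rewrite expRD -mulrA ler_wpM2l ?expR_ge0 //.
apply: le_trans (_ : \prod_(x in P) ((if x \in U then 1 - p / 2 else 1) *
    (if x \in F then 2 * p else 1)) <= _).
  apply: ler_prod => x _; rewrite /f /g; do 2 case: ifP => _; apply/andP; split; nra.
rewrite big_split /=; apply: ler_pM.
- by apply: prodr_ge0 => x _; case: ifP => _; lra.
- by apply: prodr_ge0 => x _; case: ifP => _; lra.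
- rewrite -big_mkcondr (eq_bigl (mem U)) => [|x] /=; last first.
    by case: (boolP (x \in U)) => [/(subsetP UP) ->|]; rewrite ?andbF.
  rewrite prodr_const (_ : - (p * #|U|%:R / 2) = #|U|%:R * (- (p / 2))); last by field.
  rewrite expRM_natl; apply: lerXn2r; rewrite ?nnegrE ?expR_ge0 //; first lra.
  by apply: le_trans (expR_ge1Dx _); lra.
- rewrite -big_mkcondr (eq_bigl (mem F)) => [|x] /=; last first.
    by case: (boolP (x \in F)) => [/(subsetP FP) ->|]; rewrite ?andbF.
  by rewrite prodr_const.
Qed.

Lemma prob_union_bound (I : finType) (A : pred {set X}) (B : I -> pred {set X})
    (G : pred I) :
  (forall E, E \subset P -> A E -> exists2 i, G i & B i E) ->
  prob A <= \sum_(i | G i) prob (B i).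
Proof.
move=> hAB; rewrite /prob.
under [X in _ <= X]eq_bigr do rewrite big_mkcondr.
rewrite exchange_big /= big_mkcondr; apply: ler_sum => E; rewrite powersetE => EP.
have nn j : G j -> 0 <= if B j E then weight E else 0.
  by move=> _; case: ifP => _ //; exact: weight_ge0.
case: ifP => [/(hAB E EP)[i Gi Bi]|_]; last exact: sumr_ge0.
rewrite (bigD1 i) //= Bi lerDl; apply: sumr_ge0 => j /andP[Gj _]; exact: nn.
Qed.

Lemma prob_split (A B : pred {set X}) :
  prob A <= prob B + prob (fun E => A E && ~~ B E).
Proof.
rewrite /prob [X in X <= _]big_mkcondr [X in _ <= X + _]big_mkcondr.
rewrite [X in _ <= _ + X]big_mkcondr -big_split; apply: ler_sum => E _ /=.
by have := weight_ge0 E; case: (A E); case: (B E) => /=; rewrite ?addr0 ?add0r.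
Qed.

Variable r : nat.

(** Fingerprints of distinct colour classes are disjoint, so one partial labelling encodes all [r]
    of them; [None] marks an element in no fingerprint. *)
Definition labelled (g : {ffun X -> option 'I_r}) : {set X} := [set x | g x != None].

Lemma sum_labelled (z : R) :
  \sum_(g : {ffun X -> option 'I_r} | labelled g \subset P) z ^+ #|labelled g|
    = (1 + r%:R * z) ^+ #|P|.
Proof.
pose F x (o : option 'I_r) : R :=
  if o is Some _ then (if x \in P then z else 0) else 1.
have -> : (1 + r%:R * z) ^+ #|P| = \prod_x \sum_o F x o.
  rewrite -prodr_const big_mkcond; apply: eq_bigr => x _.
  rewrite (bigD1 None) //= (eq_bigl (fun o : option 'I_r => o != None)) //.
  rewrite (reindex_omap Some id) /=; last by case.
  rewrite (eq_bigl predT) => [|i]; last by rewrite /= eqxx.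
  by case: ifP => xP; rewrite /= sumr_const card_ord ?mul0rn ?addr0 // mulr_natl.
rewrite bigA_distr_bigA /= big_mkcond; apply: eq_bigr => g _.
case: ifP => [/subsetP gP|/negbT/subsetPn[x]].
  rewrite -prodr_const big_mkcond; apply: eq_bigr => x _; rewrite inE /F.
  case E: (g x) => [i|] //=.
  by rewrite gP // inE E.
by rewrite inE (bigD1 x) //= /F; case: (g x) => // i _ /negbTE ->; rewrite mul0r.
Qed.

(** In place of binomial estimates, the size condition on [g] is relaxed to the factor
    [expR (L * (y2 - #|labelled g|%:R))], which is at least 1 when it holds. The sum over all
    labellings is then a product, and [L] stays free. *)
Lemma prob_fingerprint (A : pred {set X}) (U : {ffun X -> option 'I_r} -> {set X})
    (y1 y2 L m : R) : 0 <= L ->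
  (forall g, U g \subset P /\ m <= #|U g|%:R) ->
  (forall E, E \subset P -> A E -> exists g, [/\ labelled g \subset E,
     #|labelled g|%:R <= y2 & #|E :&: U g|%:R <= y1]) ->
  prob A <= expR (y1 + L * y2 + 2 * r%:R * p * #|P|%:R * expR (- L) - p * m / 2).
Proof.
move=> L0 hU hA.
pose G g := (labelled g \subset P) && (#|labelled g|%:R <= y2).
pose B g E := (labelled g \subset E) && (#|E :&: U g|%:R <= y1).
apply: le_trans (@prob_union_bound _ A B G _) _.
  move=> E EP /(hA E EP)[g [h1 h2 h3]]; exists g; last by rewrite /B h1.
  by rewrite /G h2 (subset_trans h1).
apply: le_trans (_ : \sum_(g | labelled g \subset P)
    expR (y1 - p * m / 2 + L * y2) * (2 * p * expR (- L)) ^+ #|labelled g| <= _).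
  rewrite big_mkcondr; apply: ler_sum => g gP.
  have z0 : 0 <= expR (y1 - p * m / 2 + L * y2) * (2 * p * expR (- L)) ^+ #|labelled g|.
    by rewrite mulr_ge0 ?expR_ge0 // exprn_ge0 // !mulr_ge0 // expR_ge0.
  case: ifP => // h2; have [UP hm] := hU g.
  apply: le_trans (prob_contains_sparse _ gP UP) _.
  rewrite [(2 * p * expR _) ^+ _]exprMn [X in _ <= X]mulrCA [X in _ <= X]mulrC ler_wpM2r //.
    by rewrite exprn_ge0 // mulr_ge0.
  rewrite -expRM_natl -expRD ler_expR.
  have : L * #|labelled g|%:R <= L * y2 by rewrite ler_wpM2l.
  have : p * m <= p * #|U g|%:R by rewrite ler_wpM2l.
  lra.
rewrite -big_distrr /= sum_labelled.
rewrite (_ : y1 + _ + _ - _ = (y1 - p * m / 2 + L * y2) +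
  #|P|%:R * (r%:R * (2 * p * expR (- L)))); last by ring.
rewrite [X in _ <= X]expRD ler_wpM2l ?expR_ge0 // expRM_natl; apply: lerXn2r.
- by rewrite nnegrE addr_ge0 // !mulr_ge0 // expR_ge0.
- by rewrite nnegrE expR_ge0.
- exact: expR_ge1Dx.
Qed.

Section SecondMoment.
Variables (T : finType) (S : {set T}) (e : T -> {set X}) (k : nat) (K u M : R).
Hypothesis k_gt0 : (0 < k)%N.
Hypothesis p_gt0 : 0 < p.
Hypothesis u_gt0 : 0 < u.
Hypothesis M_gt0 : 0 < M.
Hypothesis K_ge0 : 0 <= K.
Hypothesis e_sub : {in S, forall t, e t \subset P}.
Hypothesis uniform : {in S, forall t, #|e t| = k}.
Hypothesis card_S : #|S|%:R <= u.
Hypothesis spread : forall Q, Q != set0 ->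
  (codegree S e Q)%:R <= K * p ^+ #|Q|.-1 * u / M.

Lemma induced_sum E : #|induced S e E|%:R = \sum_(t in S) (e t \subset E)%:R :> R.
Proof. by rewrite -natr_sum -sum1dep_card big_mkcondr. Qed.

Lemma first_moment : \sum_(E in powerset P) weight E * #|induced S e E|%:R
  = #|S|%:R * p ^+ k.
Proof.
under eq_bigr do rewrite induced_sum big_distrr /=.
rewrite exchange_big /= mulr_natl -sumr_const; apply: eq_bigr => t tS.
rewrite -(uniform tS) -(prob_contains (e_sub tS)) /prob big_mkcondr.
by apply: eq_bigr => E _; case: ifP => _; rewrite ?mulr1 ?mulr0.
Qed.

(** Disjoint pairs of edges give the square of the mean. A pair meeting in [Q] has weight
    [p ^+ (2 * k - #|Q|)], and the codegree bound cancels all but one factor [p] of the gain;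
    [2 ^ k] counts the possible [Q]. *)
Lemma second_moment : \sum_(E in powerset P) weight E * #|induced S e E|%:R ^+ 2
  <= (#|S|%:R * p ^+ k) ^+ 2 + (2 ^ k)%:R * K * (u * p ^+ k) ^+ 2 / (p * M).
Proof.
have -> : \sum_(E in powerset P) weight E * #|induced S e E|%:R ^+ 2
    = \sum_(t in S) \sum_(t' in S) p ^+ #|e t :|: e t'|.
  have Esq E : weight E * #|induced S e E|%:R ^+ 2 =
      \sum_(t in S) \sum_(t' in S) weight E * (e t :|: e t' \subset E)%:R.
    rewrite induced_sum expr2 big_distrl big_distrr /=; apply: eq_bigr => t _.
    rewrite !big_distrr /=; apply: eq_bigr => t' _.
    by rewrite subUset -natrM mulnb.
  under eq_bigr do rewrite Esq.
  rewrite exchange_big /=; apply: eq_bigr => t tS.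
  rewrite exchange_big /=; apply: eq_bigr => t' t'S.
  have UP : e t :|: e t' \subset P by rewrite subUset !e_sub.
  rewrite -(prob_contains UP) /prob big_mkcondr.
  by apply: eq_bigr => E _; case: ifP => _; rewrite ?mulr1 ?mulr0.
have card2 t t' : t \in S -> t' \in S ->
    p ^+ #|e t :|: e t'| <= p ^+ k * p ^+ k + \sum_(Q in powerset (e t) | Q != set0)
      (Q \subset e t')%:R * p ^+ (k + k - #|Q|).
  move=> tS t'S; rewrite cardsU (uniform tS) (uniform t'S).
  have sn : 0 <= \sum_(Q in powerset (e t) | Q != set0)
      (Q \subset e t')%:R * p ^+ (k + k - #|Q|).
    by apply: sumr_ge0 => Q _; rewrite mulr_ge0 // exprn_ge0.
  have [->|h0] := eqVneq (e t :&: e t') set0; first by rewrite cards0 subn0 exprD lerDl.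
  rewrite (bigD1 (e t :&: e t')) /=; last by rewrite powersetE subsetIl.
  rewrite subsetIr mul1r addrCA lerDl addr_ge0 ?mulr_ge0 ?exprn_ge0 //.
  by apply: sumr_ge0 => Q _; rewrite mulr_ge0 // exprn_ge0.
apply: le_trans (_ : \sum_(t in S) (#|S|%:R * (p ^+ k * p ^+ k) +
    (2 ^ k)%:R * (K * p ^+ (k + k).-1 * u / M)) <= _).
  apply: ler_sum => t tS.
  apply: (@le_trans _ _ (\sum_(t' in S) (p ^+ k * p ^+ k +
      \sum_(Q in powerset (e t) | Q != set0) (Q \subset e t')%:R * p ^+ (k + k - #|Q|)))).
    by apply: ler_sum => t' t'S; exact: card2.
  rewrite big_split /= sumr_const -[X in X + _]mulr_natl lerD2l.
  rewrite exchange_big /=.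
  have -> : ((2 ^ k)%:R : R) = \sum_(Q in powerset (e t)) 1.
    by rewrite sumr_const card_powerset (uniform tS).
  rewrite big_distrl /= big_mkcondr; apply: ler_sum => Q; rewrite powersetE => Qt.
  have b0 : 0 <= K * p ^+ (k + k).-1 * u / M.
    by rewrite !mulr_ge0 ?exprn_ge0 ?invr_ge0 // ltW.
  rewrite mul1r; case: ifP => // Q0.
  have Qk : (0 < #|Q| <= k)%N.
    by rewrite card_gt0 Q0 -(uniform tS) subset_leq_card.
  rewrite -big_distrl /=.
  have -> : \sum_(t' in S) ((Q \subset e t')%:R : R) = (codegree S e Q)%:R.
    by rewrite -natr_sum /codegree -sum1dep_card big_mkcondr.
  apply: le_trans (ler_wpM2r (exprn_ge0 _ p_ge0) (spread Q0)) _.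
  rewrite (_ : (k + k).-1 = (#|Q|.-1 + (k + k - #|Q|))%N); last by lia.
  by rewrite exprD le_eqVlt; apply/orP; left; apply/eqP; field; rewrite gt_eqF.
rewrite sumr_const -[X in X <= _]mulr_natl.
have -> : (u * p ^+ k) ^+ 2 = u ^+ 2 * (p ^+ (k + k).-1 * p).
  by rewrite -exprSr prednK ?addn_gt0 ?k_gt0 // exprMn exprD -expr2.
have -> : #|S|%:R * (#|S|%:R * (p ^+ k * p ^+ k) + (2 ^ k)%:R * (K * p ^+ (k + k).-1 * u / M))
    = (#|S|%:R * p ^+ k) ^+ 2 + #|S|%:R * ((2 ^ k)%:R * (K * p ^+ (k + k).-1 * u / M)).
  by ring.
have -> : (2 ^ k)%:R * K * (u ^+ 2 * (p ^+ (k + k).-1 * p)) / (p * M)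
    = u * ((2 ^ k)%:R * (K * p ^+ (k + k).-1 * u / M)).
  by field; rewrite !gt_eqF.
by rewrite lerD2l ler_wpM2r // !mulr_ge0 ?exprn_ge0 ?invr_ge0 // ltW.
Qed.

(** Chebyshev's inequality: the mean is at most [u * p ^+ k], so the event is a deviation of at
    least that size. *)
Lemma prob_many_edges :
  prob (fun E => 2 * (u * p ^+ k) <= #|induced S e E|%:R) <= (2 ^ k)%:R * K / (p * M).
Proof.
set mu := #|S|%:R * p ^+ k; set v := u * p ^+ k.
have v0 : 0 < v by rewrite mulr_gt0 // exprn_gt0.
have mv : mu <= v by rewrite ler_wpM2r // exprn_ge0.
have h : prob (fun E => 2 * v <= #|induced S e E|%:R) * v ^+ 2 <=
    \sum_(E in powerset P) weight E * (#|induced S e E|%:R - mu) ^+ 2.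
  rewrite /prob big_distrl /= big_mkcondr; apply: ler_sum => E _.
  case: ifP => hE; last by rewrite mulr_ge0 ?weight_ge0 // sqr_ge0.
  by rewrite ler_wpM2l ?weight_ge0 //; apply: lerXn2r; rewrite ?nnegrE; lra.
have h2 : \sum_(E in powerset P) weight E * (#|induced S e E|%:R - mu) ^+ 2 =
    \sum_(E in powerset P) weight E * #|induced S e E|%:R ^+ 2 - mu ^+ 2.
  have -> : \sum_(E in powerset P) weight E * (#|induced S e E|%:R - mu) ^+ 2 =
      \sum_(E in powerset P) (weight E * #|induced S e E|%:R ^+ 2 +
        (- (2 * mu) * (weight E * #|induced S e E|%:R) + mu ^+ 2 * weight E)).
    by apply: eq_bigr => E _; ring.
  rewrite !big_split /= -!big_distrr /= first_moment sum_weight -/mu; ring.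
rewrite h2 in h; have h3 := second_moment; rewrite -/mu -/v in h3.
rewrite -(ler_pM2r (exprn_gt0 2 v0)); apply: le_trans h _.
rewrite (_ : _ * K / _ * _ = (2 ^ k)%:R * K * v ^+ 2 / (p * M)); last first.
  by field; rewrite !gt_eqF.
by lra.
Qed.

End SecondMoment.
End RandomSubset.

(** * Copies of a graph in a complete graph *)

Lemma card_union_bound (T I : finType) (A : {set T}) (B : I -> {set T}) :
  (forall x, x \in A -> exists i, x \in B i) -> (#|A| <= \sum_i #|B i|)%N.
Proof.
move=> h; rewrite -sum1_card.
have -> : (\sum_i #|B i| = \sum_x \sum_(i | x \in B i) 1)%N.
  under eq_bigr do rewrite -sum1_card big_mkcond.
  by rewrite exchange_big /=; apply: eq_bigr => x _; rewrite -big_mkcond.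
rewrite [X in (X <= _)%N]big_mkcond; apply: leq_sum => x _.
by case: ifP => // /h[i xi]; rewrite (bigD1 i).
Qed.

Section Copies.
Variables (W : finType) (H : sgraph W).

(** Maps are defined on all of [W], including points outside [vset H], so that every count has
    exponent [#|W|] and compares directly with the number of maps from [W]. *)
Definition embeddings (V : finType) : {set {ffun W -> V}} :=
  [set f : {ffun W -> V} | injectiveb f].

Definition copy_edges (V : finType) (f : {ffun W -> V}) : {set {set V}} :=
  [set f @: (ed : {set W}) | ed in eset H].

Lemma embeddingsP (V : finType) (f : {ffun W -> V}) :
  reflect (injective f) (f \in embeddings V).
Proof. by rewrite inE; apply: injectiveP. Qed.

Lemma edge_card (ed : {set W}) : ed \in eset H -> #|ed| = 2%N.
Proof. by move=> hed; have /forall_inP/(_ _ hed)/andP[/eqP] := sgraph_valP H. Qed.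

Lemma edge_sub (ed : {set W}) : ed \in eset H -> ed \subset vset H.
Proof. by move=> hed; have /forall_inP/(_ _ hed)/andP[] := sgraph_valP H. Qed.

Lemma copy_edges_card (V : finType) : {in embeddings V, forall f, #|copy_edges f| = #|eset H|}.
Proof.
by move=> f /embeddingsP fi; rewrite card_imset //; exact: imset_inj.
Qed.

Lemma copy_edges_pairs (V : finType) :
  {in embeddings V, forall f, copy_edges f \subset pairs V}.
Proof.
move=> f /embeddingsP fi; apply/subsetP => _ /imsetP[ed hed ->].
by rewrite inE card_imset // edge_card.
Qed.

Lemma embeddings_card (V : finType) : (#|embeddings V| <= #|V| ^ #|W|)%N.
Proof. by rewrite -card_ffun max_card. Qed.

Lemma card_ffun_into (V : finType) (A : {set W}) (D : {set V}) :
  #|[set f : {ffun W -> V} | [forall a in A, f a \in D]]|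
    = (#|D| ^ #|A| * #|V| ^ (#|W| - #|A|))%N.
Proof.
pose F (a : W) : pred V := fun v => (a \in A) ==> (v \in D).
have -> : #|[set f : {ffun W -> V} | [forall a in A, f a \in D]]| = #|family F|.
  apply: eq_card => f; rewrite inE; apply/forall_inP/familyP => [h a|h a aA].
    by apply/implyP/h.
  by have /implyP := h a; apply.
rewrite card_family foldrE big_map big_enum /= (bigID (mem A)) /=.
rewrite (eq_bigr (fun=> #|D|)) => [|a aA]; last first.
  by apply: eq_card => v; rewrite -[LHS]/((a \in A) ==> (v \in D)) aA.
rewrite prod_nat_const (eq_bigr (fun=> #|V|)) => [|a aA]; last first.
  by apply: eq_card => v; rewrite -[LHS]/((a \in A) ==> (v \in D)) (negbTE aA).
rewrite prod_nat_const; congr (_ * _ ^ _)%N.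
by rewrite -(cardC (mem A)) addKn; apply: eq_card => a; rewrite !inE.
Qed.

(* An embedding whose copy contains [Q] maps the vertices covered by some [B] with
   [#|B| = #|Q|] into the vertices covered by [Q]. *)
Lemma codegree_copies (V : finType) (Q : {set {set V}}) :
  (codegree (embeddings V) (@copy_edges V) Q <=
   \sum_(B in powerset (eset H) | #|B| == #|Q|)
     (2 * #|eset H|).+1 ^ #|W| * #|V| ^ (#|W| - #|cover B|))%N.
Proof.
(* If some embedding contains [Q], it bounds [#|Q|] by the number of edges of [H], hence also the
   number of vertices covered. *)
have [E|[f0]] := set_0Vmem [set f in embeddings V | Q \subset copy_edges f].
  by rewrite /codegree E cards0.
rewrite inE => /andP[f0i Qf0].
have coverQ : (#|cover Q| <= 2 * #|eset H|)%N.
  apply: leq_trans (leq_card_cover Q).1 _.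
  rewrite (eq_bigr (fun=> 2%N)) => [|A /(subsetP Qf0) hA].
    by rewrite sum_nat_const mulnC leq_mul // -(copy_edges_card f0i) subset_leq_card.
  by have := subsetP (copy_edges_pairs f0i) _ hA; rewrite inE => /eqP.
pose FB (B : {set {set W}}) : {set {ffun W -> V}} :=
  if (B \in powerset (eset H)) && (#|B| == #|Q|)
  then [set f : {ffun W -> V} | [forall a in cover B, f a \in cover Q]] else set0.
apply: leq_trans (@card_union_bound _ _ _ FB _) _.
  move=> f; rewrite inE => /andP[fi Qf].
  have fI := embeddingsP _ fi.
  pose B := [set ed in eset H | f @: (ed : {set W}) \in Q].
  have QB : Q = [set f @: (ed : {set W}) | ed in B].
    apply/setP => A; apply/idP/imsetP => [AQ|[ed]].
      have /imsetP[ed hed E] := subsetP Qf _ AQ.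
      by exists ed => //; rewrite inE hed -E.
    by rewrite inE => /andP[_ hQ] ->.
  exists B; rewrite /FB.
  have -> : B \in powerset (eset H).
    by rewrite powersetE; apply/subsetP => ed; rewrite inE => /andP[].
  have -> : #|B| == #|Q| by rewrite QB card_imset //; exact: imset_inj.
  rewrite /= inE; apply/forall_inP => a /bigcupP[ed edB aed].
  apply/bigcupP; exists (f @: ed); last exact: imset_f.
  by move: edB; rewrite inE => /andP[].
rewrite [X in (_ <= X)%N]big_mkcond; apply: leq_sum => B _; rewrite /FB.
case: ifP => _; last by rewrite cards0.
rewrite card_ffun_into leq_mul //.
apply: leq_trans (_ : ((2 * #|eset H|).+1 ^ #|cover B|) <= _)%N.
  by case: #|cover B| => // c; rewrite leq_exp2r // ltnW.
by rewrite leq_pexp2l // max_card.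
Qed.

(** Two edges at a common vertex form a path on three vertices, for which [d2] is
    [(2 - 1) / (3 - 2)]. *)
Lemma m2_ge1 (R : realType) : (2 <= max_degree H)%N -> 1 <= m2 R H.
Proof.
move=> hH.
have [v _ hv] : exists2 v, v \in vset H & (1 < degree H v)%N.
  apply/exists_inP; apply: contraLR hH => /exists_inPn h; rewrite -ltnNge ltnS.
  by apply/bigmax_leqP => v vH; rewrite leqNgt h.
have /card_gt1P[e1 [e2 []]] := hv.
rewrite !inE => /andP[h1 v1] /andP[h2 v2] ne.
have ax : sgraph_axiom (e1 :|: e2, [set e1; e2]).
  apply/forall_inP => ed /=; rewrite !inE => /orP[] /eqP ->.
    by rewrite edge_card //= subsetUl.
  by rewrite edge_card //= subsetUr.
pose J := SGraph ax.
have cE : #|eset J| = 2%N by rewrite cards2 ne.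
have cV : #|vset J| = 3%N.
  rewrite cardsU (edge_card h1) (edge_card h2).
  have -> : e1 :&: e2 = [set v]; last by rewrite cards1.
  apply/eqP; rewrite eq_sym eqEcard cards1 subsetI !sub1set v1 v2 /=.
  rewrite leqNgt; apply: contra ne => c2.
  have /eqP {1}<- : e1 :&: e2 == e1 by rewrite eqEcard subsetIl (edge_card h1).
  by rewrite eqEcard subsetIr (edge_card h2).
rewrite /m2; apply: (bigmax_sup J); last by rewrite /d2 cE cV /= ler_pdivlMr; lra.
rewrite cE andbT; apply/andP; split.
  by rewrite subUset !edge_sub.
by apply/subsetP => ed; rewrite !inE => /orP[] /eqP ->.
Qed.

(** This is the density of the subgraph [(cover B, B)] with denominators cleared. A single edge is
    treated apart: both sides vanish there, whatever the convention for [K_2]. *)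
Lemma edges_le_m2 (R : realType) (B : {set {set W}}) : B \subset eset H -> B != set0 ->
  (#|B|%:R - 1 <= m2 R H * (#|cover B|%:R - 2)) /\ (2 <= #|cover B|)%N.
Proof.
move=> BH /set0Pn[e1 e1B].
have e1c : e1 \subset cover B by apply: bigcup_sup.
have c2 : (2 <= #|cover B|)%N.
  by rewrite -(edge_card (subsetP BH _ e1B)) subset_leq_card.
split=> //.
have ax : sgraph_axiom (cover B, B).
  apply/forall_inP => ed /= edB; rewrite edge_card ?(subsetP BH) //=.
  exact: bigcup_sup.
pose J := SGraph ax.
have [B1|B1] := leqP #|B| 1%N.
  have B1' : #|B| = 1%N by apply/eqP; rewrite eqn_leq B1 card_gt0; apply/set0Pn; exists e1.
  have /eqP/cards1P[x Bx] := B1'.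
  have -> : cover B = e1.
    move: e1B; rewrite Bx inE => /eqP ->; by rewrite /cover big_set1.
  by rewrite B1' (edge_card (subsetP BH _ e1B)) !subrr mulr0.
have c3 : (2 < #|cover B|)%N.
  rewrite ltnNge; apply/negP => cle.
  have /card_gt1P[x [y [xB yB]]] := B1.
  have E z : z \in B -> z = cover B.
    move=> zB; apply/eqP; rewrite eqEcard (bigcup_sup z) //=.
    by rewrite (edge_card (subsetP BH _ zB)).
  by rewrite (E x xB) (E y yB) eqxx.
have : d2 R J <= m2 R H.
  rewrite /m2; apply: (bigmax_sup J) => //; apply/andP; split; last by rewrite /eset /= ltnW.
  rewrite /subgraph /vset /eset /= BH andbT; apply/bigcupsP => ed edB.
  by apply: edge_sub; apply: (subsetP BH).
rewrite /d2 /vset /eset /= (gtn_eqF c3) /= ler_pdivrMr //.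
by rewrite subr_gt0 ltr_nat.
Qed.

(** A set [B] of [b] edges covering [v] vertices extends in about [n^(w - v)] ways, with [w = #|W|].
    As [b - 1 <= m2(H) (v - 2)], the bound on [q] gives [q^(b - 1) >= n^(2 - v)], which is the claim
    for [B]. *)
Lemma copies_spread (R : realType) (n : nat) (q : R) (Q : {set {set 'I_n}}) :
    (0 < n)%N -> 0 < m2 R H -> n%:R `^ (- (m2 R H)^-1) <= q -> Q != set0 ->
  (codegree (embeddings 'I_n) (@copy_edges 'I_n) Q)%:R <=
    (2 ^ #|eset H| * (2 * #|eset H|).+1 ^ #|W|)%:R * q ^+ #|Q|.-1
      * n%:R ^+ #|W| / n%:R ^+ 2.
Proof.
move=> n0 m0 hq Q0.
have nR : 1 <= n%:R :> R by rewrite ler1n.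
have nR0 : 0 < n%:R :> R by rewrite ltr0n.
have q0 : 0 <= q by apply: le_trans hq; exact: powR_ge0.
apply: le_trans (_ : (\sum_(B in powerset (eset H))
     (2 * #|eset H|).+1%:R ^+ #|W| * (q ^+ #|Q|.-1 * n%:R ^+ #|W| / n%:R ^+ 2)) <= _);
  last first.
  rewrite sumr_const card_powerset -[X in X <= _]mulr_natl natrM.
  by rewrite (natrX _ (2 * #|eset H|).+1) !mulrA.
apply: le_trans (_ : ((\sum_(B in powerset (eset H) | #|B| == #|Q|)
     (2 * #|eset H|).+1 ^ #|W| * n ^ (#|W| - #|cover B|))%N%:R <= _)).
  by have := codegree_copies Q; rewrite card_ord ler_nat.
rewrite natr_sum big_mkcondr; apply: ler_sum => B; rewrite powersetE => BH.
have z0 : 0 <= (2 * #|eset H|).+1%:R ^+ #|W| * (q ^+ #|Q|.-1 * n%:R ^+ #|W| / n%:R ^+ 2).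
  by rewrite !mulr_ge0 ?exprn_ge0 ?invr_ge0 ?exprn_ge0 // ltW.
case: ifP => // /eqP BQ; rewrite natrM natrX ler_wpM2l ?exprn_ge0 //.
have B0 : B != set0 by rewrite -card_gt0 BQ card_gt0.
have [dB cB] := edges_le_m2 R BH B0.
rewrite natrX exprB ?max_card ?unitfE ?gt_eqF // -BQ.
rewrite (_ : q ^+ #|B|.-1 * _ / _ = n%:R ^+ #|W| * (q ^+ #|B|.-1 / n%:R ^+ 2)); last first.
  by rewrite mulrAC mulrC.
rewrite ler_wpM2l ?exprn_ge0 // ler_pdivlMr ?exprn_gt0 // mulrC ler_pdivrMr ?exprn_gt0 //.
have -> : n%:R ^+ 2 = n%:R `^ 2%:R :> R by rewrite powR_mulrn // ltW.
apply: le_trans (_ : (n%:R `^ (- (m2 R H)^-1)) ^+ #|B|.-1 * n%:R ^+ #|cover B| <= _);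
  last first.
  apply: ler_wpM2r; first by rewrite exprn_ge0.
  by apply: lerXn2r; rewrite ?nnegrE ?powR_ge0.
rewrite -!powR_mulrn ?powR_ge0 ?ler0n // -powRrM -powRD; last by rewrite (gt_eqF nR0) implybT.
rewrite ler_powR //.
have h1 : #|B|.-1%:R = #|B|%:R - 1 :> R.
  by rewrite -[in RHS](@prednK #|B|) ?card_gt0 // -natr1 addrK.
rewrite h1; have : (m2 R H)^-1 * (#|B|%:R - 1) <= #|cover B|%:R - 2.
  by rewrite mulrC ler_pdivrMr // mulrC.
by rewrite mulNr [- _ + _]addrC !lerBrDr [2 + _]addrC.
Qed.
End Copies.

(* Supersaturation in Ramsey's theorem *)
Local Close Scope ring_scope.

Lemma copy_edges2 (W V : finType) (H : sgraph W) (f : {ffun W -> V}) (a b : W) :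
  injective f -> ([set f a; f b] \in copy_edges H f) = ([set a; b] \in eset H).
Proof.
move=> fi; have E : f @: [set a; b] = [set f a; f b] by rewrite imsetU1 imset_set1.
by rewrite -E mem_imset //; exact: imset_inj.
Qed.

Lemma card_comp_preim (A B Y : finType) (h : A -> B) (F : {set {ffun A -> Y}}) :
  injective h ->
  #|[set g : {ffun B -> Y} | [ffun a => g (h a)] \in F]| = (#|F| * #|Y| ^ (#|B| - #|A|))%N.
Proof.
move=> hi; rewrite -sum1dep_card.
rewrite (partition_big (fun g : {ffun B -> Y} => [ffun a => g (h a)]) (mem F)) //=.
rewrite -sum_nat_const; apply: eq_bigr => f fF.
rewrite -(card_ffun_extension f hi) sum1dep_card; apply: eq_card => g; rewrite !inE.
apply/andP/forallP => [[_ /eqP <-] a|E]; first by rewrite ffunE.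
have -> : [ffun a => g (h a)] = f by apply/ffunP => a; rewrite ffunE; apply/eqP.
by split.
Qed.

(** A map from ['I_N] to ['I_n] either identifies two points, or sends a pair into the uncovered set
    [U], or contains an embedding of [W] with all pairs in one [C i], hence a copy of [H] there. For
    [n >= 4 * N ^ 2] the first and third kinds are at most a quarter of the maps each, so half of
    them meet [U]. *)
Lemma ramsey_supersaturation (W : finType) (H : sgraph W) (r : nat) :
    0 < r -> 1 < #|W| ->
  exists2 N, 0 < N & forall (n : nat) (C : 'I_r -> {set {set 'I_n}}),
    4 * N ^ 2 <= n ->
    (forall i, 4 * r * N ^ #|W| *
       #|induced (embeddings W 'I_n) (@copy_edges W H 'I_n) (C i)| <= n ^ #|W|) ->
    n ^ 2 <= 8 * N ^ 2 * #|pairs 'I_n :\: \bigcup_i C i|.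
Proof.
move=> r0 W2; have [N hN] := ramsey_multicolor W r0.
have [i0 [h0 [h0i _]]] := hN (fun _ _ => Ordinal r0) (fun _ _ => erefl).
have WN : #|W| <= N by have := leq_card _ h0i; rewrite card_ord.
exists N => [|n C nN hC]; first by apply: leq_trans WN; apply: ltnW.
set U := _ :\: _; set S := embeddings W 'I_n; set e := @copy_edges W H 'I_n.
pose clash (x : 'I_N * 'I_N) : {set {ffun 'I_N -> 'I_n}} := [set g : {ffun 'I_N -> 'I_n} |
  (x.1 != x.2) && ((g x.1 == g x.2) || ([set g x.1; g x.2] \in U))].
pose mono (x : {ffun W -> 'I_N} * 'I_r) : {set {ffun 'I_N -> 'I_n}} :=
  if injectiveb x.1 then [set g : {ffun 'I_N -> 'I_n} |
    [ffun a => g (x.1 a)] \in induced S e (C x.2)] else set0.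
have cover_all : n ^ N <= \sum_x #|clash x| + \sum_x #|mono x|.
  have -> : n ^ N = #|[set: {ffun 'I_N -> 'I_n}]| by rewrite cardsT card_ffun !card_ord.
  apply: leq_trans (_ : #|[set g | [exists x, g \in clash x]]| +
      #|[set g | [exists x, g \in mono x]]| <= _); last first.
    by apply: leq_add; apply: card_union_bound => g; rewrite inE => /existsP.
  apply: leq_trans (leq_card_setU _ _); apply: subset_leq_card; apply/subsetP => g _.
  rewrite !inE; case: (boolP [exists x, g \in clash x]) => //= /existsPn ncl.
  have ncl' x y : x != y -> g x != g y /\ exists i, [set g x; g y] \in C i.
    move=> xy; have := ncl (x, y); rewrite inE /= xy /= negb_or => /andP[gxy].
    rewrite inE negb_and negbK inE cards2 gxy orbF => /bigcupP[i _ hi].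
    by split => //; exists i.
  (* The sets [C i] may overlap, so a colour is chosen; the default concerns only [x = y]. *)
  pose chi x y := odflt (Ordinal r0) [pick i | [set g x; g y] \in C i].
  have chiC x y : chi x y = chi y x by rewrite /chi setUC.
  have chiP x y : x != y -> [set g x; g y] \in C (chi x y).
    by move=> /ncl'[_ [i hi]]; rewrite /chi; case: pickP => //= /(_ i); rewrite hi.
  have [i [h [hi hchi]]] := hN chi chiC.
  have hi' : injective [ffun a => h a] by move=> a b; rewrite !ffunE => /hi.
  apply/existsP; exists ([ffun a => h a], i); rewrite /mono /=.
  case: injectiveP => // _; rewrite !inE /=; apply/andP; split.
    apply/injectiveP => a b; rewrite !ffunE => gab.
    apply: hi; apply/eqP; apply: contraT => /ncl'[]; by rewrite gab eqxx.
  apply/subsetP => _ /imsetP[ed hed ->].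
  have /eqP/cards2P[a [b [ab ->]]] := edge_card hed.
  rewrite imsetU1 imset_set1 !ffunE -(hchi a b ab); apply: chiP.
  by apply: contra ab => /eqP/hi/eqP.
have clash_le x : #|clash x| <= (n + 4 * #|U|) * n ^ (N - 2).
  have [xx|xx] := eqVneq x.1 x.2.
    by rewrite /clash (_ : [set g | _] = set0) ?cards0 //; apply/setP => g; rewrite !inE xx eqxx.
  pose hx (b : bool) := if b then x.1 else x.2.
  have hxi : injective hx.
    by move=> [] [] //= E; move: xx; rewrite ?E ?eqxx // -E eqxx.
  pose F : {set {ffun bool -> 'I_n}} :=
    [set g : {ffun bool -> 'I_n} | (g true == g false) || ([set g true; g false] \in U)].
  have -> : #|clash x| = #|[set g : {ffun 'I_N -> 'I_n} | [ffun a => g (hx a)] \in F]|.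
    by apply: eq_card => g; rewrite !inE !ffunE /= xx.
  rewrite card_comp_preim // card_bool !card_ord leq_mul2r; apply/orP; right.
  pose D : {set {ffun bool -> 'I_n}} := [set g : {ffun bool -> 'I_n} | g true == g false].
  apply: leq_trans (_ : #|D| + \sum_(e in U) #|[set g : {ffun bool -> 'I_n} |
      (g true \in e) && (g false \in e)]| <= _).
    pose G (e : {set 'I_n}) : {set {ffun bool -> 'I_n}} := if e \in U then
      [set g : {ffun bool -> 'I_n} | (g true \in e) && (g false \in e)] else set0.
    apply: leq_trans (_ : #|D| + \sum_e #|G e| <= _).
      apply: leq_trans (_ : #|D| + #|[set g | [exists e, g \in G e]]| <= _); last first.
        by rewrite leq_add2l; apply: card_union_bound => g; rewrite inE => /existsP.
      apply: leq_trans (leq_card_setU _ _); apply: subset_leq_card; apply/subsetP => g.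
      rewrite !inE => /orP[->//|gU]; apply/orP; right; apply/existsP.
      exists [set g true; g false]; have gU' : [set g true; g false] \in U by rewrite !inE.
      by rewrite /G gU' !inE !eqxx orbT.
    rewrite leq_add2l [X in _ <= X]big_mkcond; apply: leq_sum => e0 _; rewrite /G.
    by case: ifP; rewrite ?cards0.
  apply: leq_add.
    rewrite -[X in _ <= X](card_ord n).
    apply: leq_trans (@leq_card_in _ _ (fun g : {ffun bool -> 'I_n} => g true) (mem D) _) _.
      move=> g g'; rewrite !inE => /eqP E /eqP E' tt.
      by apply/ffunP => -[] //; rewrite -E -E'.
    exact: max_card.
  rewrite mulnC -sum_nat_const; apply: leq_sum => e0; rewrite !inE => /andP[_ /eqP e2].
  have -> : #|[set g : {ffun bool -> 'I_n} | (g true \in e0) && (g false \in e0)]|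
      = #|[set g : {ffun bool -> 'I_n} | [forall a in [set: bool], g a \in e0]]|.
    apply: eq_card => g; rewrite !inE; apply/andP/forall_inP => [[h1 h2] []//|h].
    by split; apply: h.
  by rewrite card_ffun_into cardsT card_bool e2 subnn expn0.
have mono_le x : 4 * r * N ^ #|W| * #|mono x| <= n ^ N.
  rewrite /mono; case: injectiveP => [xi|_]; last by rewrite cards0 muln0.
  rewrite card_comp_preim // !card_ord mulnA.
  apply: leq_trans (leq_mul (hC x.2) (leqnn _)) _.
  by rewrite -expnD subnKC.
have s1 : \sum_x #|clash x| <= N ^ 2 * ((n + 4 * #|U|) * n ^ (N - 2)).
  have -> : N ^ 2 = #|{: 'I_N * 'I_N}| by rewrite card_prod !card_ord mulnn.
  by rewrite -sum_nat_const; apply: leq_sum => x _; exact: clash_le.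
have s2 : 4 * \sum_x #|mono x| <= n ^ N.
  have : 4 * r * N ^ #|W| * \sum_x #|mono x| <= N ^ #|W| * r * n ^ N.
    have -> : N ^ #|W| * r = #|{: {ffun W -> 'I_N} * 'I_r}|.
      by rewrite card_prod card_ffun !card_ord.
    by rewrite big_distrr /= -sum_nat_const; apply: leq_sum => x _; exact: mono_le.
  have NW0 : 0 < N ^ #|W| * r by rewrite muln_gt0 r0 expn_gt0 (leq_trans (ltnW W2) WN).
  move=> hs; rewrite -(leq_pmul2l NW0); apply: leq_trans hs.
  by rewrite leq_eqVlt; apply/orP; left; apply/eqP; ring.
have nE : n ^ N = n ^ 2 * n ^ (N - 2) by rewrite -expnD subnKC // (leq_trans W2).
have n0 : 0 < n by apply: leq_trans nN; rewrite muln_gt0 expn_gt0 (leq_trans (ltnW W2) WN).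
have P0 : 0 < n ^ (N - 2) by rewrite expn_gt0 n0.
rewrite -(leq_pmul2r P0); rewrite nE in cover_all s2.
move: (n ^ (N - 2)) (\sum_x #|clash x|) (\sum_x #|mono x|) cover_all s1 s2 => P A B c1 s1 s2.
have h5 : 4 * N ^ 2 * (n * P) <= n * (n * P) by rewrite leq_mul2r nN orbT.
move: (N ^ 2) #|U| h5 s1 => Q u h5 s1; rewrite -mulnn in c1 s2 *.
lia.
Qed.

(** * Transversals of a coloured blowup *)

Section Transversal.
Variables (W V : finType) (H : sgraph W) (G : sgraph V) (N r : nat) (i0 : 'I_r).
Variable col : {e : {set V * 'I_N} | e \in eset (blowup N G)} -> 'I_r.

(** The colouring is extended to all sets to avoid carrying membership proofs; [i0] is the value off
    the edges of the blowup. *)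
Definition color (x : {set V * 'I_N}) : 'I_r := odflt i0 (omap col (insub x)).

Definition lift_map (f : W -> V) (s : W -> 'I_N) (a : W) : V * 'I_N := (f a, s a).

Definition mono_transversals (f : W -> V) (i : 'I_r) : {set {ffun W -> 'I_N}} :=
  [set s : {ffun W -> 'I_N} |
    [forall ed in eset H, color (lift_map f s @: (ed : {set W})) == i]].

Definition color_class (tau : {ffun V -> 'I_N}) (i : 'I_r) : {set {set V}} :=
  [set ed in eset G | color ((fun v => (v, tau v)) @: (ed : {set V})) == i].

Lemma mono_transversalsP (f : {ffun W -> V}) (tau : {ffun V -> 'I_N}) (i : 'I_r) :
  (f \in induced (embeddings W V) (@copy_edges W H V) (color_class tau i)) =
  (f \in induced (embeddings W V) (@copy_edges W H V) (eset G)) &&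
  ([ffun a => tau (f a)] \in mono_transversals f i).
Proof.
rewrite ![in LHS]inE ![in RHS]inE -!andbA; congr (_ && _).
have E ed : (fun v => (v, tau v)) @: (f @: (ed : {set W}))
    = lift_map f [ffun a => tau (f a)] @: ed.
  by rewrite -imset_comp; apply: eq_imset => a; rewrite /= /lift_map ffunE.
apply/subsetP/andP => [h|[/subsetP h1 /forall_inP h2] _ /imsetP[ed hed ->]].
  split; first by apply/subsetP => x /h; rewrite inE => /andP[].
  apply/forall_inP => ed hed; rewrite -E.
  by have := h (f @: ed) (imset_f _ hed); rewrite inE => /andP[].
rewrite inE h1 ?imset_f //= E; exact: h2.
Qed.

(** Average over [tau]: for a fixed embedding [f], the composite of [f] and [tau] is uniform among
    maps from [W] to ['I_N], so it lies in [mono_transversals f i] with probability at most [1 / d].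
    Summing over colours costs the factor [r]. *)
Lemma sparse_transversal (d : nat) : 0 < N -> #|W| <= #|V| ->
    (forall f i, f \in embeddings W V -> copy_edges H f \subset eset G ->
       d * #|mono_transversals f i| <= N ^ #|W|) ->
  exists tau : {ffun V -> 'I_N}, forall i,
    d * #|induced (embeddings W V) (@copy_edges W H V) (color_class tau i)| <=
    r * #|induced (embeddings W V) (@copy_edges W H V) (eset G)|.
Proof.
move=> N0 WV hd; set S := embeddings W V; set e := @copy_edges W H V.
suff [tau htau] : exists tau : {ffun V -> 'I_N},
    d * \sum_i #|induced S e (color_class tau i)| <= r * #|induced S e (eset G)|.
  exists tau => i; apply: leq_trans htau; rewrite leq_mul2l; apply/orP; right.
  by rewrite (bigD1 i) //= leq_addr.
apply/existsP; apply: contraT => /existsPn h.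
have : \sum_(tau : {ffun V -> 'I_N}) (r * #|induced S e (eset G)|).+1
    <= \sum_(tau : {ffun V -> 'I_N}) d * \sum_i #|induced S e (color_class tau i)|.
  by apply: leq_sum => tau _; have := h tau; rewrite -ltnNge.
have -> : \sum_(tau : {ffun V -> 'I_N}) d * \sum_i #|induced S e (color_class tau i)|
    = \sum_(i < r) \sum_(f in induced S e (eset G))
        d * #|[set tau : {ffun V -> 'I_N} | [ffun a => tau (f a)] \in mono_transversals f i]|.
  rewrite -big_distrr /= exchange_big /= big_distrr /=; apply: eq_bigr => i _.
  rewrite -big_distrr /=; congr (_ * _).
  under eq_bigr do rewrite -sum1_card.
  under [RHS]eq_bigr do rewrite -sum1dep_card big_mkcond.
  rewrite [RHS]exchange_big /=; apply: eq_bigr => tau _.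
  rewrite -big_mkcondr; apply: eq_bigl => f; exact: mono_transversalsP.
have : \sum_(i < r) \sum_(f in induced S e (eset G))
        d * #|[set tau : {ffun V -> 'I_N} | [ffun a => tau (f a)] \in mono_transversals f i]|
    <= \sum_(i < r) \sum_(f in induced S e (eset G)) N ^ #|V|.
  apply: leq_sum => i _; apply: leq_sum => f; rewrite inE => /andP[fS fG].
  rewrite card_comp_preim; last exact/embeddingsP.
  rewrite card_ord mulnA; apply: leq_trans (leq_mul (hd f i fS fG) (leqnn _)) _.
  by rewrite -expnD subnKC.
rewrite !sum_nat_const card_ffun !card_ord => h1 h2.
have := leq_trans h2 h1; have : 0 < N ^ #|V| by rewrite expn_gt0 N0.
by move: (N ^ _) #|induced S e _| => A B; nia.
Qed.

Lemma subst_axiom (H' : sgraph V) (S : V -> {set V * 'I_N}) :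
  (forall v, S v \subset part N v) -> sgraph_axiom (substV H' S, substE H' S).
Proof.
move=> hS.
apply/forall_inP => ed /= /bigcupP[v vG] /bigcupP[w /andP[wG vwG]].
case/imset2P => x y xv yw ->.
have /forall_inP/(_ _ vwG) := sgraph_valP H'.
rewrite cards2; case: (eqVneq v w) => // nvw _.
have := subsetP (hS v) _ xv; have := subsetP (hS w) _ yw; rewrite !inE => /eqP yw1 /eqP xv1.
have nxy : x != y by apply: contraNneq nvw => xy; rewrite -xv1 -yw1 xy eqxx.
rewrite cards2 nxy /=; apply/subsetP => z; rewrite !inE.
by case/orP => /eqP ->; apply/bigcupP; [exists v | exists w].
Qed.

(** The set replacing [f a] consists of the values at [a] of the [t] tuples: injectivity at each
    coordinate gives its size. An edge between two such sets is a shadow pair, hence is an edge of a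
    transversal all of whose edges over [H] have colour [i]. *)
Lemma dense_mono_copy (d t : nat) (f : {ffun W -> V}) (i : 'I_r) :
    (forall (F : {set #|W|.-tuple 'I_N}), N ^ #|W| <= d * #|F| ->
      exists s : 'I_t -> #|W|.-tuple 'I_N,
      [/\ forall i, s i \in F,
          forall a, injective (fun i => tnth (s i) a) &
          forall a b i j, a != b -> shadow F a b (tnth (s i) a) (tnth (s j) b)]) ->
    vset G = [set: V] -> injective f -> copy_edges H f \subset eset G ->
    N ^ #|W| <= d * #|mono_transversals f i| ->
  exists2 K, canonical_copy H t G K & monochromatic K col.
Proof.
move=> hsh GT fi fG hmono.
set F := [set fgraph s | s in mono_transversals f i].
have cF : #|F| = #|mono_transversals f i| by rewrite card_imset //; exact: can_inj fgraphK.
have [|s [sF si ssh]] := hsh F; first by rewrite cF.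
have axH' : sgraph_axiom (f @: vset H, copy_edges H f).
  apply/forall_inP => _ /= /imsetP[ed hed ->].
  by rewrite card_imset // (edge_card hed) /= imsetS // edge_sub.
pose H' := SGraph axH'.
pose sv j a := tnth (s j) (enum_rank a).
pose S (v : V) : {set V * 'I_N} :=
  [set x | (x.1 == v) && [exists a, [exists j, x == (f a, sv j a)]]].
have SE a : S (f a) = [set (f a, sv j a) | j : 'I_t].
  apply/setP => x; rewrite inE; apply/andP/imsetP => [[/eqP xa]|[j _ ->]].
    case/existsP => b /existsP[j /eqP xE]; exists j => //.
    by move: xa; rewrite xE /= => /fi ->.
  split=> //; apply/existsP; exists a; apply/existsP; by exists j.
have Spart v : S v \subset part N v by apply/subsetP => x; rewrite !inE => /andP[].
pose K := SGraph (subst_axiom H' Spart).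
have H'G : subgraph H' G by rewrite /subgraph GT subsetT.
exists K.
  split.
    apply/andP; split.
      by apply/subsetP => x _; apply/bigcupP; exists x.1; rewrite ?GT ?inE.
    apply/subsetP => x /bigcupP[v _ /bigcupP[w /andP[_ vw] /imset2P[y z yv zw ->]]].
    apply/bigcupP; exists v; first by rewrite GT inE.
    apply/bigcupP; exists w; first by rewrite GT inE; apply: (subsetP fG).
    by apply: imset2_f; [apply: (subsetP (Spart v))|apply: (subsetP (Spart w))].
  exists H', S; split => //.
    by exists f; split => // x y _ _ /fi.
  move=> _ /imsetP[a _ ->]; split; first exact: Spart.
  by rewrite SE card_imset ?card_ord // => j j' [/si].
exists i => ed /bigcupP[v vH /bigcupP[w /andP[wH vw] /imset2P[x y]]].
case/imsetP: vH vw => a _ -> ; case/imsetP: wH => b _ -> vw.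
rewrite !SE => /imsetP[j _ ->] /imsetP[j' _ ->] edE.
have abH : [set a; b] \in eset H by rewrite -(@copy_edges2 _ _ _ f).
have ab : a != b by have := edge_card abH; rewrite cards2; case: (a != b).
have ab' : enum_rank a != enum_rank b by rewrite (inj_eq enum_rank_inj).
have /exists_inP[_ /imsetP[u hu ->]] := ssh _ _ j j' ab'.
rewrite !tnth_fgraph !enum_rankK => /andP[/eqP ua /eqP ub].
move: hu; rewrite inE => /forall_inP/(_ _ abH)/eqP <-.
rewrite imsetU1 imset_set1 /lift_map ua ub -/(sv j a) -/(sv j' b) -edE.
by rewrite /color valK.
Qed.

End Transversal.

(** * Fingerprints of colourings without monochromatic canonical copies *)

From mathcomp Require Import boolp.

Local Open Scope ring_scope.

(** By contraposition of [dense_mono_copy], no embedded copy has many monochromatic transversals, so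
    some [tau] splits [E] into [r] classes inducing few copies. An edge of [E] outside every
    container has leaked from that of its own class, and the leak of each class is bounded by its
    copies. *)
Lemma fingerprint_of_nonramsey (R : realType) (W : finType) (H : sgraph W)
    (n r N t d : nat) (phi zeta : {set {set 'I_n}} -> {set {set 'I_n}}) (y lam s : R)
    (E : {set {set 'I_n}}) :
  let ind := induced (embeddings W 'I_n) (@copy_edges W H 'I_n) in
    (0 < r)%N -> (0 < N)%N -> (#|W| <= n)%N -> 0 <= s -> E \subset pairs 'I_n ->
    (forall (F : {set #|W|.-tuple 'I_N}), (N ^ #|W| <= d * #|F|)%N ->
      exists s : 'I_t -> #|W|.-tuple 'I_N,
      [/\ forall i, s i \in F,
          forall a, injective (fun i => tnth (s i) a) &
          forall a b i j, a != b -> shadow F a b (tnth (s i) a) (tnth (s j) b)]) ->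
    (forall I, [/\ phi I \subset I, zeta (phi I) = zeta I, #|phi I|%:R <= y &
       #|(I :&: pairs 'I_n) :\: zeta I|%:R * lam <= s * #|ind I|%:R]) ->
    0 <= lam ->
    ~ @canonically_ramsey 'I_n N W r H t (spanning_graph E) ->
  exists g : {ffun {set 'I_n} -> option 'I_r},
    [/\ labelled g \subset E, #|labelled g|%:R <= r%:R * y &
        d%:R * (#|E :&: (pairs 'I_n :\: \bigcup_i zeta [set x | g x == Some i])|%:R * lam)
          <= r%:R * (s * (r%:R * #|ind E|%:R))].
Proof.
move=> ind r0 N0 Wn s0 EP hsh hcont lam0 /existsNP[col ncol].
set G := spanning_graph E in col ncol.
have esetG : eset G = E by apply/setIidPl.
have hd f i : f \in embeddings W 'I_n -> copy_edges H f \subset eset G ->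
    (d * #|mono_transversals H (Ordinal r0) col f i| <= N ^ #|W|)%N.
  move=> /embeddingsP fi fG; rewrite leqNgt; apply/negP => hlt; apply: ncol.
  exact: (dense_mono_copy hsh _ fi fG (ltnW hlt)).
have [|tau htau] := sparse_transversal N0 _ hd; first by rewrite card_ord.
pose I i := color_class (Ordinal r0) col tau i.
have IE i : I i \subset E.
  by rewrite -esetG; apply/subsetP => x; rewrite inE => /andP[].
have phiI i : phi (I i) \subset I i by case: (hcont (I i)).
pose g := [ffun x : {set 'I_n} => [pick i | x \in phi (I i)]].
(* The fingerprints lie in distinct colour classes, so at most one [i] can be picked. *)
have gE x i : (g x == Some i) = (x \in phi (I i)).
  rewrite ffunE; case: pickP => [i' hi'|h]; last by rewrite h.
  apply/eqP/idP => [[<-]//|hi]; congr Some.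
  have := subsetP (phiI _) _ hi'; have := subsetP (phiI _) _ hi.
  by rewrite !inE => /andP[_ /eqP <-] /andP[_ /eqP <-].
have labE i : [set x | g x == Some i] = phi (I i) by apply/setP => x; rewrite inE gE.
have lab x : x \in labelled g -> exists i, x \in phi (I i).
  by rewrite inE; case E': (g x) => [i|] // _; exists i; rewrite -gE E'.
exists g; split.
- by apply/subsetP => x /lab[i /(subsetP (phiI i))]; exact: (subsetP (IE i)).
- apply: le_trans (_ : (\sum_i #|phi (I i)|)%N%:R <= _).
    by rewrite ler_nat; exact: card_union_bound lab.
  rewrite natr_sum mulr_natl -[r in X in _ <= X]card_ord -sumr_const.
  by apply: ler_sum => i _; case: (hcont (I i)).
- have h1 : (#|E :&: (pairs 'I_n :\: \bigcup_i zeta [set x | g x == Some i])|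
      <= \sum_i #|(I i :&: pairs 'I_n) :\: zeta (I i)|)%N.
    apply: card_union_bound => x; rewrite in_setI in_setD => /and3P[xE xz xP].
    pose i := color (Ordinal r0) col ((fun v => (v, tau v)) @: (x : {set 'I_n})).
    exists i; rewrite in_setD in_setI xP andbT inE esetG xE eqxx andbT /=.
    rewrite andbT; apply: contraNN xz => xz; apply/bigcupP; exists i => //.
    by rewrite labE; case: (hcont (I i)) => _ ->.
  apply: le_trans (_ : d%:R * (\sum_i (s * #|ind (I i)|%:R)) <= _).
    rewrite ler_wpM2l //.
    apply: le_trans (_ : (\sum_i #|(I i :&: pairs 'I_n) :\: zeta (I i)|)%N%:R * lam <= _).
      by rewrite ler_wpM2r // ler_nat.
    rewrite natr_sum big_distrl /=; apply: ler_sum => i _.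
    by case: (hcont (I i)).
  rewrite big_distrr /=; have -> z : r%:R * z = \sum_(i < r) z.
    by rewrite sumr_const card_ord mulr_natl.
  apply: ler_sum => i _; rewrite mulrCA ler_wpM2l // -!natrM ler_nat.
  by have := htau i; rewrite esetG.
Qed.

(** Here [x] counts edges outside all containers and [z] copies of [H], while [Cj] and [qj] stand
    for [C ^+ j] and [q ^+ j]. Since [p ^+ j = Cj * qj], the powers of [q] cancel and only [Cj] is
    left for [d] to dominate. *)
Lemma leak_arith (R : realFieldType) (d lk qj nw n2 r s z x Cj p eta : R) :
    0 < d -> 0 < lk -> 0 < qj -> 0 < nw -> 0 < n2 -> 0 <= r -> 0 <= s -> 0 <= p ->
    d * (x * (lk * qj * nw / n2)) <= r * (s * (r * z)) ->
    z <= 2 * (nw * (p * (Cj * qj))) -> 16 * r ^+ 2 * s * Cj <= d * (lk * eta) ->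
  x <= eta * p * n2 / 8.
Proof.
move=> d0 lk0 q0 nw0 n20 r0 s0 p0 h hz hd.
have l0 : 0 < d * (lk * qj * nw / n2) by rewrite mulr_gt0 // divr_gt0 // !mulr_gt0.
rewrite -(ler_pM2l l0) (_ : _ * x = d * (x * (lk * qj * nw / n2))); last by ring.
apply: le_trans h _.
apply: le_trans (_ : r * (s * (r * (2 * (nw * (p * (Cj * qj)))))) <= _).
  by do 3 apply: ler_wpM2l => //.
have -> : r * (s * (r * (2 * (nw * (p * (Cj * qj))))))
    = (16 * r ^+ 2 * s * Cj) * (nw * p * qj / 8) by field.
have -> : d * (lk * qj * nw / n2) * (eta * p * n2 / 8) = d * (lk * eta) * (nw * p * qj / 8).
  by field; rewrite gt_eqF.
by apply: ler_wpM2r hd; rewrite divr_ge0 // !mulr_ge0 // ltW.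
Qed.

(** The bound [expR (- L) <= L^-1] makes the labelling term small, then a large [C] makes the
    fingerprint term small. In units of [eta * p * n2] the exponent is at most
    [1/8 + 1/16 + 1/16 - 1/2]. *)
Lemma exponent_arith (R : realType) (L a C eta p r n2 P : R) :
    0 < L -> 0 <= a -> 0 < C -> 0 < p -> 0 < r -> 0 < n2 -> P <= n2 ->
    32 * r <= L * eta -> 16 * L * a <= C * eta ->
  eta * p * n2 / 8 + L * (a * (p / C * n2)) + 2 * r * p * P * expR (- L)
    - p * (eta * n2) / 2 <= - (eta * (p * n2) / 4).
Proof.
move=> L0 a0 C0 p0 r0 n20 Pn hL hC; have m0 : 0 < p * n2 by rewrite mulr_gt0.
have e1 : L * (a * (p / C * n2)) <= eta * (p * n2) / 16.
  have -> : L * (a * (p / C * n2)) = 16 * L * a * (p * n2 / (16 * C)).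
    by field; rewrite gt_eqF.
  have -> : eta * (p * n2) / 16 = C * eta * (p * n2 / (16 * C)) by field; rewrite gt_eqF.
  by apply: ler_wpM2r hC; rewrite divr_ge0 // ?ltW // mulr_gt0.
have e2 : 2 * r * p * P * expR (- L) <= eta * (p * n2) / 16.
  have eL : expR (- L) <= L^-1.
    rewrite expRN lef_pV2 ?posrE ?expR_gt0 //.
    by apply: le_trans (expR_ge1Dx L); rewrite lerDr.
  have rp0 : 0 < 2 * r * p by rewrite !mulr_gt0.
  apply: le_trans (_ : 2 * r * p * n2 * L^-1 <= _).
    apply: le_trans (_ : 2 * r * p * n2 * expR (- L) <= _).
      by apply: ler_wpM2r; [exact: expR_ge0|apply: ler_wpM2l => //; exact: ltW].
    by apply: ler_wpM2l eL; rewrite ltW // mulr_gt0.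
  rewrite ler_pdivrMr //.
  have -> : 2 * r * p * n2 = 32 * r * (p * n2 / 16) by field.
  have -> : eta * (p * n2) / 16 * L = L * eta * (p * n2 / 16) by field.
  by apply: ler_wpM2r hL; rewrite divr_ge0 // ltW.
have -> : eta * p * n2 / 8 = eta * (p * n2) / 8 by rewrite mulrA.
have -> : p * (eta * n2) / 2 = eta * (p * n2) / 2 by rewrite mulrCA.
lra.
Qed.

Lemma max_degree_edges (W : finType) (H : sgraph W) : (max_degree H <= #|eset H|)%N.
Proof.
apply/bigmax_leqP => v _; apply: subset_leq_card; apply/subsetP => ed.
by rewrite inE => /andP[].
Qed.

Lemma failure_probability (R : realType) (r : nat) (W : finType) (H : sgraph W) :
    (2 <= r)%N -> (2 <= max_degree H)%N ->
  exists (c n0 : nat) (C B : R), [/\ (0 < c)%N, 1 <= C, 0 <= B &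
    forall (n t : nat) (p : R), (n0 <= n)%N -> 0 <= p -> p <= 1 ->
      C * n%:R `^ (- (m2 R H)^-1) <= p -> (0 < t)%N ->
      prob (pairs 'I_n) p (fun E =>
        ~~ `[< @canonically_ramsey 'I_n (c ^ t)%N W r H t (spanning_graph E) >])
      <= B / n%:R].
Proof.
move=> r2 hH; have m1 : 1 <= m2 R H by exact: m2_ge1.
have m0 : 0 < m2 R H by apply: lt_le_trans m1.
have r0 : (0 < r)%N by apply: ltnW.
have k2 : (2 <= #|eset H|)%N := leq_trans hH (max_degree_edges H).
have [ed hed] : exists ed, ed \in eset H by apply/set0Pn; rewrite -card_gt0 ltnW.
have W2 : (1 < #|W|)%N by rewrite -(edge_card hed) max_card.
set k := #|eset H| in k2; set w := #|W| in W2.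
pose j := k.-1; have jk : j.+1 = k by rewrite prednK // ltnW.
have [N N0 hN] := ramsey_supersaturation H r0 W2.
(* [eps] is the density of copies that [ramsey_supersaturation] tolerates in each container, [eta]
   the proportion of pairs that it then leaves uncovered. *)
pose eps : R := ((4 * r * N ^ w)%N%:R)^-1.
have D0 : (0 < 4 * r * N ^ w)%N by rewrite !muln_gt0 r0 expn_gt0 N0.
have eps0 : 0 < eps by rewrite invr_gt0 ltr0n.
pose eta : R := ((8 * N ^ 2)%N%:R)^-1.
have N20 : (0 < 8 * N ^ 2)%N by rewrite muln_gt0 expn_gt0 N0.
have eta0 : 0 < eta by rewrite invr_gt0 ltr0n.
pose K : R := (2 ^ k * (2 * k).+1 ^ w)%:R.
have K0 : 0 < K by rewrite ltr0n muln_gt0 !expn_gt0.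
have sh0 := shrink_gt0 j eps0 K0.
pose s := Num.bound (shrink j eps K)^-1.
have hs : 1 < s%:R * shrink j eps K.
  by rewrite -ltr_pdivrMr // div1r archi_boundP // invr_ge0 ltW.
have lk0 := leak_gt0 j eps0 K0; set lk := leak j eps K in lk0.
have rR : 0 < r%:R :> R by rewrite ltr0n.
have [L L0 hL] : exists2 L : R, 0 < L & 32 * r%:R <= L * eta.
  by exists (32 * r%:R / eta); rewrite ?divfK ?gt_eqF // divr_gt0 // mulr_gt0.
have [a a0 aE] : exists2 a : R, 0 <= a & a = r%:R * (s%:R * (2 * j%:R)).
  by exists (r%:R * (s%:R * (2 * j%:R))); rewrite // !mulr_ge0.
have [C C1 hC] : exists2 C : R, 1 <= C & 16 * L * a <= C * eta.
  have La0 : 0 <= 16 * L * a by rewrite !mulr_ge0 // ltW.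
  exists (16 * L * a / eta + 1); first by rewrite lerDr divr_ge0 // ltW.
  by rewrite [X in _ <= X]mulrDl divfK ?gt_eqF // mul1r lerDl ltW.
have C0 : 0 < C by apply: lt_le_trans C1.
(* The required density of monochromatic transversals is [1 / d]; it depends on [C] but not on [t],
   so the base [c] obtained from it serves all [t]. *)
have [d d0 hd] : exists2 d : nat, (0 < d)%N &
    16 * r%:R ^+ 2 * s%:R * C ^+ j <= d%:R * (lk * eta).
  have le0 : 0 < lk * eta by apply: mulr_gt0.
  exists (Num.bound (16 * r%:R ^+ 2 * s%:R * C ^+ j / (lk * eta))).+1 => //.
  rewrite -ler_pdivrMr // ltW // (lt_trans (archi_boundP _)) ?ltr_nat //.
  by rewrite divr_ge0 ?(ltW le0) // !mulr_ge0 // ?exprn_ge0 // ltW.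
have [c c0 hc] := blowup_in_shadow w d0.
(* The first term comes from the second moment, the second from [expR (- x) <= x^-1] applied to the
   union bound. *)
pose B : R := (2 ^ k)%:R * K + 4 / eta.
exists c, (maxn (4 * N ^ 2) w), C, B; split => //.
  have K2 : 0 <= (2 ^ k)%:R * K by rewrite mulr_ge0 // ltW.
  by rewrite addr_ge0 // divr_ge0 // ltW.
move=> n t p; rewrite geq_max => /andP[nN wn] p0 p1 hp t0.
have n0 : (0 < n)%N by apply: leq_trans wn; apply: ltnW.
have nR : 0 < n%:R :> R by rewrite ltr0n.
have n1 : 1 <= n%:R :> R by rewrite ler1n.
have pw : n%:R^-1 <= n%:R `^ (- (m2 R H)^-1).
  rewrite -(powR_inv1 (ltW nR)).
  by rewrite ler_powR // lerN2 invf_le1.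
pose q := p / C.
have hq : n%:R `^ (- (m2 R H)^-1) <= q by rewrite ler_pdivlMr // mulrC.
have q0 : 0 < q by apply: lt_le_trans hq; rewrite powR_gt0.
have qp : q <= p by rewrite ler_pdivrMr // ler_peMr.
have pp : 0 < p by apply: lt_le_trans qp.
have q1 : q <= 1 by apply: le_trans p1.
have hpw : n%:R `^ (- (m2 R H)^-1) <= p by apply: le_trans qp.
have M0 : 0 < n%:R ^+ 2 :> R by rewrite exprn_gt0.
have u0 : 0 < n%:R ^+ w :> R by rewrite exprn_gt0.
have qn : n%:R <= q * n%:R ^+ 2.
  rewrite -ler_pdivrMr // expr2 invfM mulrA divff ?gt_eqF // mul1r.
  exact: le_trans hq.
have pn : n%:R <= p * n%:R ^+ 2 by apply: le_trans qn _; rewrite ler_wpM2r // ltW.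
have qM : 1 <= q * n%:R ^+ 2 by apply: le_trans qn.
have PM : #|pairs 'I_n|%:R <= n%:R ^+ 2 :> R.
  rewrite -natrX ler_nat; have -> : (n ^ 2 = #|{: 'I_n * 'I_n}|)%N.
    by rewrite card_prod !card_ord mulnn.
  apply: leq_trans (_ : #|[set [set x.1; x.2] | x : 'I_n * 'I_n]| <= _)%N.
    apply: subset_leq_card; apply/subsetP => e; rewrite inE => /cards2P[x [y [_ ->]]].
    by apply/imsetP; exists (x, y).
  exact: leq_imset_card.
have uniq : {in embeddings W 'I_n, forall f, #|copy_edges H f| = j.+1}.
  by move=> f /copy_edges_card ->; rewrite jk.
have sub := @copy_edges_pairs W H 'I_n.
have spr (q' : R) : n%:R `^ (- (m2 R H)^-1) <= q' -> forall Q : {set {set 'I_n}}, Q != set0 ->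
    (codegree (embeddings W 'I_n) (@copy_edges W H 'I_n) Q)%:R <=
    K * q' ^+ #|Q|.-1 * n%:R ^+ w / n%:R ^+ 2.
  by move=> hq' Q Q0; exact: copies_spread.
have [phi [zeta hcont]] := hypergraph_containers eps0 K0 hs q0 q1 M0 PM qM u0 sub uniq (spr q hq).
have cS : #|embeddings W 'I_n|%:R <= n%:R ^+ w :> R.
  by rewrite -natrX ler_nat; apply: leq_trans (embeddings_card _ _) _; rewrite card_ord.
pose many (E : {set {set 'I_n}}) := 2 * (n%:R ^+ w * p ^+ k) <=
  #|induced (embeddings W 'I_n) (@copy_edges W H 'I_n) E|%:R.
have hmany : prob (pairs 'I_n) p many <= (2 ^ k)%:R * K / (p * n%:R ^+ 2).
  apply: prob_many_edges => //; [exact: ltnW|exact: copy_edges_card|exact: spr].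
(* Graphs with too many copies of [H] are set aside first, because the leak is charged to the total
   number of copies. *)
apply: le_trans (prob_split _ p0 p1 _ many) _.
pose U (g : {ffun {set 'I_n} -> option 'I_r}) :=
  pairs 'I_n :\: \bigcup_i zeta [set x | g x == Some i].
have hfp : prob (pairs 'I_n) p (fun E =>
    ~~ `[< @canonically_ramsey 'I_n (c ^ t)%N W r H t (spanning_graph E) >] && ~~ many E)
    <= expR (eta * p * n%:R ^+ 2 / 8 + L * (a * (q * n%:R ^+ 2))
        + 2 * r%:R * p * #|pairs 'I_n|%:R * expR (- L) - p * (eta * n%:R ^+ 2) / 2).
  apply: (@prob_fingerprint _ _ _ _ p0 p1 r _ U) => //; first exact: ltW.
    move=> g; split; first exact: subsetDl.
    have := hN n (fun i => zeta [set x | g x == Some i]) nN; rewrite -/(U g) => h.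
    rewrite mulrC ler_pdivrMr ?ltr0n // -natrX -natrM ler_nat mulnC; apply: h => i.
    have [_ _ _ + _] := hcont [set x | g x == Some i].
    rewrite mulrC ltr_pdivlMr ?ltr0n // -natrX -natrM ltr_nat mulnC; exact: ltnW.
  move=> E EP /andP[/asboolPn nram nmany].
  have ct : (0 < c ^ t)%N by rewrite expn_gt0 c0.
  pose lam := lk * q ^+ j * n%:R ^+ w / n%:R ^+ 2.
  have lam0 : 0 < lam by rewrite divr_gt0 // !mulr_gt0 // exprn_gt0.
  have [||g [g1 g2 g3]] := @fingerprint_of_nonramsey R W H n r (c ^ t)%N t d phi zeta
    (s%:R * (2 * j%:R * (q * n%:R ^+ 2))) lam s%:R E r0 ct wn (ler0n _ _) EP _ _ (ltW lam0) nram.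
  - by move=> F hF; apply: hc => //; rewrite card_ord.
  - by move=> I; have [h1 h2 h3 _ h5] := hcont I.
  exists g; split => //.
    by apply: le_trans g2 _; rewrite aE le_eqVlt; apply/orP; left; apply/eqP; ring.
  rewrite -/(U g) in g3 *.
  set x := #|_|%:R in g3 *; set z := #|_|%:R in g3.
  have zlt : z < 2 * (n%:R ^+ w * p ^+ k) by rewrite ltNge.
  have pE : p ^+ k = p * (C ^+ j * q ^+ j).
    by rewrite -jk exprS -exprMn /q mulrCA divff ?mulr1 // gt_eqF.
  apply: (leak_arith _ lk0 _ u0 M0 _ _ p0 g3 _ hd) => //; rewrite ?ltr0n ?exprn_gt0 //.
  by rewrite -pE ltW.
set m := p * n%:R ^+ 2 in hmany pn.
have m_gt0 : 0 < m by apply: lt_le_trans pn.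
have em0 : 0 < eta * m by apply: mulr_gt0.
have e3 : expR (eta * p * n%:R ^+ 2 / 8 + L * (a * (q * n%:R ^+ 2))
        + 2 * r%:R * p * #|pairs 'I_n|%:R * expR (- L) - p * (eta * n%:R ^+ 2) / 2)
    <= 4 / eta / m.
  apply: le_trans (_ : expR (- (eta * m / 4)) <= _).
    by rewrite ler_expR; exact: exponent_arith.
  have E4 (x y : R) : 4 / x / y = (x * y / 4)^-1 by rewrite invf_div invfM mulrA.
  rewrite E4 expRN lef_pV2 ?posrE ?expR_gt0 ?divr_gt0 //.
  by apply: le_trans (expR_ge1Dx _); rewrite lerDr.
apply: le_trans (lerD hmany (le_trans hfp e3)) _.
rewrite -mulrDl -/B; apply: ler_wpM2l; last by rewrite lef_pV2 ?posrE.
have K2 : 0 <= (2 ^ k)%:R * K by rewrite mulr_ge0 // ltW.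
by rewrite addr_ge0 // divr_ge0 // ltW.
Qed.

(* Passage to the limit *)
From HB Require Import structures.
From mathcomp Require Import all_classical all_reals all_analysis.

Import numFieldNormedType.Exports.

Local Open Scope classical_set_scope.

Lemma ceil_nat_exp (R : realType) (c t : nat) : ceil_nat ((c%:R : R) ^+ t) = (c ^ t)%N.
Proof. by rewrite /ceil_nat -natrX pmulrn intrKceil. Qed.

Theorem theorem1p2 (R : realType) (r : nat) (W : finType) (H : sgraph W)
    (hr : (2 <= r)%N) (hH : (2 <= max_degree H)%N) :
  exists c C : R, [/\ 0 < c, 0 < C &
    forall p : nat -> R,
      (forall n, 0 <= p n <= 1) ->
      (\forall n \near \oo, C * n%:R `^ (- (m2 R H)^-1) <= p n) ->
      forall t : nat, (0 < t)%N ->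
        (fun n => Gnp_prob (p n)
          (@canonically_ramsey 'I_n (ceil_nat (c ^+ t)) W r H t)) @ \oo --> (1 : R)].
Proof.
have [c [n0 [C [B [c0 C1 B0 hB]]]]] := failure_probability R hr hH.
exists c%:R, C; split; rewrite ?ltr0n ?(lt_le_trans ltr01) //.
move=> p p01 pC t t0; rewrite ceil_nat_exp.
apply/cvgrPdist_le => eps eps0; near=> n.
have /andP[p0 p1] := p01 n.
set A := fun E : {set {set 'I_n}} =>
  `[< @canonically_ramsey 'I_n (c ^ t)%N W r H t (spanning_graph E) >].
have -> : Gnp_prob (p n) (@canonically_ramsey 'I_n (c ^ t)%N W r H t)
    = 1 - prob (pairs 'I_n) (p n) (fun E => ~~ A E).
  rewrite -(sum_weight (pairs 'I_n) (p n)) (bigID A) /= addrK.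
  by [].
rewrite opprB addrC subrK ger0_norm; last first.
  by apply: sumr_ge0 => E _; exact: weight_ge0.
have n0n : (n0 <= n)%N by near: n; exact: nbhs_infty_ge.
have npos : (0 < n)%N by near: n; exact: nbhs_infty_gt.
apply: le_trans (hB n t (p n) n0n p0 p1 _ t0) _; first by near: n.
rewrite ler_pdivrMr ?ltr0n // mulrC -ler_pdivrMr //.
by near: n; exact: nbhs_infty_ger.
Unshelve. all: by end_near.
Qed.
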